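(* Let $P\subseteq\mathbb{R}^d$ be a full-dimensional polytope, let $\mathbf p\in\mathbb{R}^d$ be a nonzero vector, and let $V(\mathbf z)$, $V(x,\mathbf z)$, $B_+,B_0,B_-$, $D$, $H$ and $P_{/\mathbf p}$ be as defined in the context. There exists a unique pair of rational functions $W_+=W_+(\mathbf z)$ and $W_-=W_-(\mathbf z)$ satisfying the following properties: 1. $W_+(\mathbf z)+W_-(\mathbf z)=V(\mathbf z)$; 2. $W_{\pm}(\mathbf z)=A_{\pm}(\mathbf z)/\bigl(B_{\pm}(\mathbf z)B_0(\mathbf z)D(\mathbf z)\bigr)$ for some polynomial $A_\pm(\mathbf z)$; 3. writing $\mathbf z=\mathbf z_0+t\mathbf p$ with $\mathbf z_0\in H$, one has $\lim_{t\to\infty}t\,W_\pm(\mathbf z_0+t\mathbf p)=\pm\mathrm{Vol}^\vee_{\mathbf z_0}(P_{/\mathbf p})/\|\mathbf p\|^2$. Consequently, $V(x,\mathbf z)=W_+(\mathbf z+x\mathbf p)+W_-(\mathbf z-x\mathbf p)$.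
   Context: Support function: $h_Q(\mathbf v)=-\min_{\mathbf y\in Q}\langle\mathbf v,\mathbf y\rangle$, so $h_{Q-\mathbf z}(\mathbf v)=h_Q(\mathbf v)+\langle\mathbf v,\mathbf z\rangle$. For a full-dimensional polytope $Q\subset\mathbb{R}^d$ with normal fan $\mathcal N(Q)$ (cones $\{\mathbf v:h_Q(\mathbf v)=-\langle\mathbf v,\mathbf y\rangle\ \forall\mathbf y\in F\}$ for faces $F$), and any triangulation $\mathcal T$ of $\mathcal N(Q)$ into full-dimensional simplicial cones generated by rays of $\mathcal N(Q)$, the dual volume function is the rational function $$\mathrm{Vol}^\vee_{\mathbf z}(Q)=\sum_{C=\mathrm{span}_{\ge0}(\mathbf v_1,\dots,\mathbf v_d)\in\mathcal T}\frac{|\det(\mathbf v_1,\dots,\mathbf v_d)|}{\prod_{j}h_{Q-\mathbf z}(\mathbf v_j)},$$ independent of $\mathcal T$ and scaling of generators. $V(\mathbf z)=\mathrm{Vol}^\vee_{\mathbf z}(P)$ and $V(x,\mathbf z)=\mathrm{Vol}^\vee_{\mathbf z}(P+x[-\mathbf p,\mathbf p])$ (for $x>0$, viewed as a rational function of $x$ and $\mathbf z$). Explicitly, writing $\mathcal N'=\mathcal N(P+[-\mathbf p,\mathbf p])$ and letting $\mathcal T'$ be any triangulation of $\mathcal N'$ into full-dimensional simplicial cones generated by rays of $\mathcal N'$, $$V(x,\mathbf z)=\sum_{C=\mathrm{span}_{\ge0}(\mathbf v_1,\dots,\mathbf v_d)\in\mathcal T'}\frac{|\det(\mathbf v_1,\dots,\mathbf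 v_d)|}{\prod_{j=1}^{d}\bigl(h_P(\mathbf v_j)+x|\langle\mathbf p,\mathbf v_j\rangle|+\langle\mathbf v_j,\mathbf z\rangle\bigr)}.$$ $H=\{\mathbf v:\langle\mathbf v,\mathbf p\rangle=0\}$, $H_{>0}=\{\langle\mathbf v,\mathbf p\rangle>0\}$, $H_{<0}=\{\langle\mathbf v,\mathbf p\rangle<0\}$. Fix a generator of each ray of $\mathcal N'$ (every ray of $\mathcal N(P)$ is a ray of $\mathcal N'$, which is the refinement of $\mathcal N(P)$ by $H$). $B_+(\mathbf z),B_0(\mathbf z),B_-(\mathbf z)$ are the products of the linear factors $h_{P-\mathbf z}(\mathbf v)$ over the generators $\mathbf v$ of those rays of $\mathcal N(P)$ lying in $H_{>0}$, $H$, $H_{<0}$ respectively. $D(\mathbf z)$ is the product of $h_{P-\mathbf z}(\mathbf v)$ over the generators $\mathbf v$ of rays of $\mathcal N'$ that are not rays of $\mathcal N(P)$. $P_{/\mathbf p}\subset H$ is the orthogonal projection of $P$ to $H$. Its dual volume function in $H$ is normalized using the normal vector $\mathbf p$: for $\mathbf z_0\in H$, $$\mathrm{Vol}^\vee_{\mathbf z_0}(P_{/\mathbf p})=\sum_{\mathrm{span}_{\ge0}(\mathbf v_1,\dots,\mathbf v_{d-1})}\frac{|\det(\mathbf v_1,\dots,\mathbf v_{d-1},\mathbf p)|}{\prod_{j=1}^{d-1}\bigl(h_{P_{/\mathbf p}}(\mathbf v_j)+\langle\mathbf v_j,\mathbf z_0\rangle\bigr)},$$ the sum over the cones of any triangulation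 of the normal fan of $P_{/\mathbf p}$ in $H$ into $(d-1)$-dimensional simplicial cones generated by its rays. *)

(* Defs.v *)
From HB Require Import structures.
From mathcomp Require Import all_boot all_order all_algebra.
From mathcomp Require Import all_classical all_reals all_analysis.
From mathcomp Require Import fraction.
(* The notations of mpoly clash with those of MathComp-Analysis. *)
From mathcomp Require Import -(notations) mpoly.

Set Implicit Arguments.
Unset Strict Implicit.
Unset Printing Implicit Defensive.

Import Order.TTheory GRing.Theory Num.Theory.
Import numFieldNormedType.Exports.

Local Open Scope classical_set_scope.
Local Open Scope ring_scope.

Notation "''RX[' R ]_ d" := (mpoly d R)
  (at level 0, d at level 2, format "''RX[' R ]_ d") : type_scope.
Notation "''RF[' R ]_ d" := {fraction (mpoly d R)}
  (at level 0, d at level 2, format "''RF[' R ]_ d") : type_scope.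

Section Geometry.
Variables (R : realType) (d : nat).
Implicit Types (P Q A F H : set 'rV[R]_d) (p u v y z : 'rV[R]_d).

(* The norm carried by 'rV[R]_d in MathComp-Analysis is the sup norm, so the
   squared Euclidean norm of p is always written dot p p. *)
Definition dot u v : R := \sum_(i < d) u 0 i * v 0 i.

Definition conv_hull A : set 'rV[R]_d :=
  [set x | exists m (y : 'I_m -> 'rV[R]_d) (c : 'I_m -> R),
    [/\ forall i, A (y i), forall i, 0 <= c i, \sum_i c i = 1
      & x = \sum_i c i *: y i]].

Definition aff_hull A : set 'rV[R]_d :=
  [set x | exists m (y : 'I_m -> 'rV[R]_d) (c : 'I_m -> R),
    [/\ forall i, A (y i), \sum_i c i = 1 & x = \sum_i c i *: y i]].

Definition polytope P : Prop :=
  exists s : seq 'rV[R]_d, P = conv_hull [set` s].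

Definition full_dim P : Prop := aff_hull P = setT.

(* h_Q(v) = - min_{y in Q} <v, y>; on a nonempty polytope inf is a min. *)
Definition support_fun Q v : R := - inf [set dot v y | y in Q].

Definition minkowski_sum P Q : set 'rV[R]_d := [set y + z | y in P & z in Q].

Definition sym_segment p : set 'rV[R]_d := [set c *: p | c in `[-1, 1]%classic].

Definition hyperplane p : set 'rV[R]_d := [set v | dot v p = 0].

Definition orth_proj p y : 'rV[R]_d := y - (dot y p / dot p p) *: p.

(* The nonempty faces of Q; u = 0 gives Q itself. *)
Definition polytope_face Q F : Prop :=
  F !=set0 /\
  exists u, F = [set y | Q y /\ forall y', Q y' -> dot u y <= dot u y'].

(* Normal fan of Q in a linear subspace H of R^d (H = setT: the usual one). *)
Definition normal_cone H Q F : set 'rV[R]_d :=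
  [set v | H v /\ forall y, F y -> support_fun Q v = - dot v y].

Definition normal_fan H Q : set (set 'rV[R]_d) :=
  [set normal_cone H Q F | F in polytope_face Q].

Definition half_line v : set 'rV[R]_d := [set c *: v | c in [set c | 0 <= c]].

Definition ray_gen H Q v : Prop := v != 0 /\ normal_fan H Q (half_line v).

Definition ray_gens H Q (G : seq 'rV[R]_d) : Prop :=
  [/\ uniq G,
      forall v, v \in G -> ray_gen H Q v
    & forall w, ray_gen H Q w ->
        exists! v, v \in G /\ half_line v = half_line w].

(* Cone spanned by the rows of M with index in I. *)
Definition span_subcone k (M : 'M[R]_(k, d)) (I : {set 'I_k}) : set 'rV[R]_d :=
  [set v | exists c : 'rV[R]_k,
    [/\ forall i, 0 <= c 0 i, forall i, i \notin I -> c 0 i = 0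
      & v = c *m M]].

Definition span_cone k (M : 'M[R]_(k, d)) : set 'rV[R]_d :=
  span_subcone M [set: 'I_k]%SET.

(* T lists, without repetition, the maximal cones of a triangulation of the
   normal fan of Q in H, each cone being given by the matrix whose rows are
   its generators; k is meant to be the dimension of H. *)
Definition triangulation H Q k (T : seq 'M[R]_(k, d)) : Prop :=
  [/\ uniq T,
      forall M, M \in T ->
        [/\ row_free M, forall i, ray_gen H Q (row i M)
          & exists2 C, normal_fan H Q C & span_cone M `<=` C],
      \bigcup_(M in [set` T]) span_cone M = \bigcup_(C in normal_fan H Q) C,
      {in T &, injective (@span_cone k)}
    & forall M N, M \in T -> N \in T -> exists I J,
        span_cone M `&` span_cone N = span_subcone M I
        /\ span_cone M `&` span_cone N = span_subcone N J].

(* h_{Q - z}(v) = h_Q(v) + <v, z> as a polynomial in z. *)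
Definition dual_factor Q v : 'RX[R]_d :=
  mpolyC d (support_fun Q v) + \sum_(i < d) v 0 i *: mpolyX R (mnm1 i).

Definition dual_vol Q (T : seq 'M[R]_d) : 'RF[R]_d :=
  \sum_(M <- T) tofrac (mpolyC d `|\det M|)
                / \prod_(j < d) tofrac (dual_factor Q (row j M)).

End Geometry.

Section RationalFunctions.
Variables (R : realType) (d : nat).

(* Value of f at z: a(z) / b(z) for any representation f = a / b with
   b(z) != 0, and 0 if f has a pole at z. *)
Definition rat_eval (f : 'RF[R]_d) (z : 'rV[R]_d) : R :=
  xget 0 [set r | exists a b : 'RX[R]_d,
    [/\ meval (z 0) b != 0, f = tofrac a / tofrac b
      & r = meval (z 0) a / meval (z 0) b]].

Definition poly_subst e (l : 'I_d -> 'RX[R]_e) (a : 'RX[R]_d) : 'RX[R]_e :=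
  comp_mpoly (mktuple l) a.

(* f(l_1, ..., l_d): a(l) / b(l) for any f = a / b with b(l) != 0. *)
Definition rat_subst e (l : 'I_d -> 'RX[R]_e) (f : 'RF[R]_d) : 'RF[R]_e :=
  xget 0 [set g | exists a b : 'RX[R]_d,
    [/\ poly_subst l b != 0, f = tofrac a / tofrac b
      & g = tofrac (poly_subst l a) / tofrac (poly_subst l b)]].

End RationalFunctions.

Section Deformation.
Variables (R : realType) (n : nat).
Local Notation d := n.+1.
Implicit Types (P : set 'rV[R]_d) (p v z : 'rV[R]_d) (G : seq 'rV[R]_d).

(* In d.+1 variables, variable 0 is x and variable i + 1 is z_i. *)
Definition x_var : 'RX[R]_(d.+1) := mpolyX R (mnm1 (ord0 : 'I_d.+1)).
Definition z_var (i : 'I_d) : 'RX[R]_(d.+1) := mpolyX R (mnm1 (lift ord0 i)).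

(* h_P(v) + x |<p, v>| + <v, z> = h_{P + x[-p, p] - z}(v) for x > 0 *)
Definition dual_factor_x P p v : 'RX[R]_(d.+1) :=
  mpolyC d.+1 (support_fun P v) + `|dot p v| *: x_var
  + \sum_(i < d) v 0 i *: z_var i.

Definition dual_vol_x P p (T : seq 'M[R]_d) : 'RF[R]_(d.+1) :=
  \sum_(M <- T) tofrac (mpolyC d.+1 `|\det M|)
                / \prod_(j < d) tofrac (dual_factor_x P p (row j M)).

(* the substitution z := z + x p *)
Definition shift_along p (i : 'I_d) : 'RX[R]_(d.+1) := z_var i + p 0 i *: x_var.

Definition quotient_polytope P p : set 'rV[R]_d := orth_proj p @` P.

(* No factor in the denominators of dual_vol_proj vanishes at z0. *)
Definition proj_regular P p (T0 : seq 'M[R]_(n, d)) z0 : Prop :=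
  forall M, M \in T0 -> forall j,
    support_fun (quotient_polytope P p) (row j M) + dot (row j M) z0 != 0.

(* Value at z0 in H of the dual volume function of P_{/p}. Inserting p as first
   rather than last row does not change the absolute value of the determinant. *)
Definition dual_vol_proj P p (T0 : seq 'M[R]_(n, d)) z0 : R :=
  \sum_(M <- T0) `|\det (col_mx p M : 'M[R]_d)|
     / \prod_(j < n)
         (support_fun (quotient_polytope P p) (row j M) + dot (row j M) z0).

Definition is_old_ray P v : bool := `[< ray_gen setT P v >].

Definition B_pos P p G : 'RX[R]_d :=
  \prod_(v <- G | is_old_ray P v && (0 < dot v p)) dual_factor P v.
Definition B_zero P p G : 'RX[R]_d :=
  \prod_(v <- G | is_old_ray P v && (dot v p == 0)) dual_factor P v.
Definition B_neg P p G : 'RX[R]_d :=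
  \prod_(v <- G | is_old_ray P v && (dot v p < 0)) dual_factor P v.
Definition D_new P G : 'RX[R]_d :=
  \prod_(v <- G | ~~ is_old_ray P v) dual_factor P v.

Definition has_denominator (W : 'RF[R]_d) (B : 'RX[R]_d) : Prop :=
  exists A : 'RX[R]_d, W = tofrac A / tofrac B.

(* The limits are identities of rational functions of z0; they are required
   wherever the right-hand side is defined. *)
Definition is_splitting P p (T : seq 'M[R]_d) (T0 : seq 'M[R]_(n, d)) G
    (W : 'RF[R]_d * 'RF[R]_d) : Prop :=
  [/\ W.1 + W.2 = dual_vol P T,
      has_denominator W.1 (B_pos P p G * B_zero P p G * D_new P G)
      /\ has_denominator W.2 (B_neg P p G * B_zero P p G * D_new P G)
    & forall z0, hyperplane p z0 -> proj_regular P p T0 z0 ->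
        (t * rat_eval W.1 (z0 + t *: p) @[t --> +oo]
           --> dual_vol_proj P p T0 z0 / dot p p)
        /\ (t * rat_eval W.2 (z0 + t *: p) @[t --> +oo]
           --> - (dual_vol_proj P p T0 z0 / dot p p))].

End Deformation.

(* Main.v *)
(* Triangulations enter only through the indicator functions of their cones, up
   to finitely many hyperplanes: [cone_relation] shows, by induction on the
   dimension, that a linear relation between the indicator functions of simplices
   is also satisfied by their volumes. Hence V can be computed from any
   triangulation T' of the refined fan N', on whose cones h_P is linear. The cones
   of T' on the two sides of H give W_+ and W_-, and V(x, z) splits accordingly.
   As t goes to infinity, the only terms of t W_+(z_0 + t p) that survive are those
   of cones with a facet in H; these facets cover H, which can be seen by moving
   a generic point of H slightly in direction p, so the same principle identifies
   the limit with the dual volume of P_{/p}.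
   For uniqueness, restrict the difference E of two candidates for W_+ to a generic
   line z_0 + t p. The factors of B_0 and D are constant there, while those of B_+
   and B_- have no common zero, since P lies in no hyperplane; so E is a polynomial
   in t, and t E tends to 0, whence E = 0. *)
Require Import Defs.
From mathcomp Require Import all_boot all_order all_algebra.
From mathcomp Require Import all_classical all_reals all_analysis.
From mathcomp Require Import fraction.
From mathcomp Require Import -(notations) mpoly.
From mathcomp Require Import ring lra.

Set Implicit Arguments.
Unset Strict Implicit.
Unset Printing Implicit Defensive.

Import Order.TTheory GRing.Theory Num.Theory.
Import numFieldNormedType.Exports.

Local Open Scope classical_set_scope.
Local Open Scope ring_scope.

(** * Volumes of simplicial cones *)

(** A summand of a dual volume is an actual volume only where its factors h_P(v) + <v, z> are
    positive: it is then the normalised volume of the cone truncated at level 1 of this function. An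
    interior point of P makes all factors positive, so identities are proved on an open region of z
    and extended as identities of rational functions. The limits, however, are required at every
    regular z_0 in H, where factors may be negative and where regularity is expressed through the
    generators of T0 only. It must therefore be shown that each ray of the refined fan lying in H
    is, up to scaling, one of these generators. Cones in H are one dimension too small for the
    volume principle. They are completed by p, which is also how the determinant normalising the
    dual volume of P_{/p} arises. Replacing p by -p changes neither the segment [-p, p] nor H nor
    P_{/p}, so W_- is W_+ for -p and only the side of p needs a proof. *)

Lemma small_perturbation (F : realFieldType) (s : seq (F * F)) :
  exists2 e : F, 0 < e & forall ab, ab \in s -> ab.1 != 0 -> e * `|ab.2| < `|ab.1|.
Proof.
elim: s => [|[a b] s [e e0 He]]; first by exists 1.
have [->|a0] := eqVneq a 0.
  exists e => // ab; rewrite inE => /orP[/eqP->|/He//]; by rewrite /= eqxx.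
exists (Num.min e (`|a| / (1 + `|b|))).
  by rewrite lt_min e0 divr_gt0 ?normr_gt0 ?ltr_pwDl.
have b1 : 0 < 1 + `|b| by rewrite ltr_pwDl.
move=> ab; rewrite inE => /orP[/eqP-> /= _|/He {}He /He].
  apply: (@le_lt_trans _ _ ((`|a| / (1 + `|b|)) * `|b|)).
    by rewrite ler_wpM2r // ge_min lexx orbT.
  by rewrite mulrAC ltr_pdivrMr // mulrDr mulr1 ltrDr normr_gt0.
by apply: le_lt_trans; rewrite ler_wpM2r // ge_min lexx.
Qed.

Lemma perturb_ge0 (F : realFieldType) (a b : F) :
  a != 0 -> `|b| < `|a| -> (0 <= a + b) = (0 <= a).
Proof.
case: (ltrgt0P a) => // a_gt0 _; rewrite ltr_norml => /andP[h1 h2].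
  by apply: ltW; rewrite -(subrr a) ltrD2l.
by apply: lt_geF; rewrite -(subrr a) ltrD2l.
Qed.

Lemma perturb_neq0 (F : realFieldType) (a b : F) : `|b| < `|a| -> a + b != 0.
Proof. by rewrite addr_eq0; apply: contraTneq => ->; rewrite normrN ltxx. Qed.

Lemma big_neq_lift (T : Type) (idx : T) (op : Monoid.com_law idx) D
    (i : 'I_D.+1) (F : 'I_D.+1 -> T) :
  \big[op/idx]_(k | k != i) F k = \big[op/idx]_(k < D) F (lift i k).
Proof.
rewrite (reindex_omap (lift i) (unlift i)) /=; last first.
  by move=> k kj; case: unliftP kj => [k' ->//|->]; rewrite eqxx.
by apply: eq_bigl => k; rewrite liftK eqxx andbT eq_sym neq_lift.
Qed.

Section ConeRelation.
Variable F : realFieldType.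

Definition cone_coord D (M : 'M[F]_D) (x : 'rV_D) : 'rV_D := x *m invmx M.

Definition in_cone D (M : 'M[F]_D) (x : 'rV_D) : bool :=
  [forall i, 0 <= cone_coord M x 0 i].

Definition avoids D (Hs : seq 'cV[F]_D) (x : 'rV_D) : bool :=
  all (fun c => (x *m c) 0 0 != 0) Hs.

Lemma cone_coordE D (M : 'M[F]_D) x i : cone_coord M x 0 i = (x *m col i (invmx M)) 0 0.
Proof. by rewrite !mxE; apply: eq_bigr => j _; rewrite mxE. Qed.

Lemma cone_coordD D (M : 'M[F]_D) x y : cone_coord M (x + y) = cone_coord M x + cone_coord M y.
Proof. exact: mulmxDl. Qed.

Lemma cone_coordZ D (M : 'M[F]_D) a x : cone_coord M (a *: x) = a *: cone_coord M x.
Proof. by rewrite /cone_coord -scalemxAl. Qed.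

Lemma mulmx_col_invmx D (M : 'M[F]_D) i : M \in unitmx ->
  M *m col i (invmx M) = delta_mx i 0.
Proof. by move=> uM; rewrite colE mulmxA mulmxV // mul1mx. Qed.

Lemma col_invmx_neq0 D (M : 'M[F]_D) i : M \in unitmx -> col i (invmx M) != 0.
Proof.
move=> uM; apply: contraTneq isT => h; have := mulmx_col_invmx i uM.
by rewrite h mulmx0 => /colP/(_ i); rewrite !mxE !eqxx => /esym/eqP; rewrite oner_eq0.
Qed.

(* Scaled so that each hyperplane gets a single normal vector. *)
Definition pivot D (c : 'cV[F]_D.+1) : 'I_D.+1 :=
  odflt ord0 [pick j | c j 0 != 0].
Definition normal_of D (c : 'cV[F]_D.+1) : 'cV_D.+1 := (c (pivot c) 0)^-1 *: c.

Lemma pivot_neq0 D (c : 'cV[F]_D.+1) : c != 0 -> c (pivot c) 0 != 0.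
Proof.
move=> c0; rewrite /pivot; case: pickP => //= h; case/negP: c0.
by apply/eqP/colP => j; rewrite mxE; apply/eqP; have := h j; move/negbFE.
Qed.

Lemma pivotZ D (c : 'cV[F]_D.+1) a : a != 0 -> pivot (a *: c) = pivot c.
Proof.
move=> a0; rewrite /pivot; congr odflt; apply: eq_pick => j.
by rewrite mxE mulf_eq0 (negbTE a0).
Qed.

Lemma normal_of_pivot D (c : 'cV[F]_D.+1) :
  c != 0 -> normal_of c (pivot (normal_of c)) 0 = 1.
Proof.
move=> c0; rewrite pivotZ ?invr_eq0 ?pivot_neq0 // mxE mulVf //.
exact: pivot_neq0.
Qed.

Lemma normal_of_eq D (c nu : 'cV[F]_D.+1) : c != 0 -> normal_of c = nu ->
  c = c (pivot nu) 0 *: nu.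
Proof.
move=> c0 <-; rewrite pivotZ ?invr_eq0 ?pivot_neq0 // scalerA divff ?scale1r //.
exact: pivot_neq0.
Qed.

Lemma normal_ofZ D (c nu : 'cV[F]_D.+1) a : a != 0 -> c != 0 ->
  normal_of (a *: c) = normal_of c.
Proof.
move=> a0 c0; rewrite /normal_of pivotZ // scalerA mxE; congr (_ *: _).
by rewrite invfM mulrAC mulVf // mul1r.
Qed.

(** Cramer's rule; it converts the volume of a facet into that of its simplex, up to one entry of
    the facet normal. *)
Lemma det_minor D (M : 'M[F]_D.+1) i j : M \in unitmx ->
  `|\det (row' i (col' j M))| = `|invmx M j i| * `|\det M|.
Proof.
move=> uM; rewrite -normrM /invmx uM !mxE mulrAC mulVf ?mul1r; last first.
  by rewrite -unitfE -unitmxE.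
by rewrite /cofactor normrM normrX normrN1 expr1n mul1r.
Qed.

(** * Facets of a simplicial cone, in coordinates on their hyperplane *)

Section Facet.
Variables (D : nat) (nu : 'cV[F]_D.+1) (j0 : 'I_D.+1).
Hypothesis nu1 : nu j0 0 = 1.

(** Inverse of the deletion of coordinate j0 on the hyperplane of nu, where [nu j0 0 = 1] lets the
    other coordinates determine this one. In these coordinates a functional c restricts to
    [row' j0 (c - c j0 0 *: nu)]. *)
Definition lift_pt (y : 'rV[F]_D) : 'rV[F]_D.+1 :=
  \row_k if unlift j0 k is Some k' then y 0 k' else - (y *m row' j0 nu) 0 0.

Lemma sum_lift (f : 'I_D.+1 -> F) : \sum_k f k = f j0 + \sum_(k < D) f (lift j0 k).
Proof.
by rewrite (bigD1 j0) //= big_neq_lift.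
Qed.

Lemma lift_pt_col' y : col' j0 (lift_pt y) = y.
Proof. by apply/rowP => k; rewrite !mxE liftK. Qed.

Lemma lift_pt_mul y c :
  (lift_pt y *m c) 0 0 = (y *m row' j0 (c - c j0 0 *: nu)) 0 0.
Proof.
rewrite mxE sum_lift mxE unlift_none !mxE mulNr mulr_suml -sumrN -big_split /=.
by apply: eq_bigr => k _; rewrite !mxE liftK; ring.
Qed.

Lemma lift_pt_nu y : (lift_pt y *m nu) 0 0 = 0.
Proof.
by rewrite lift_pt_mul nu1 scale1r subrr mxE big1 // => k _; rewrite !mxE mulr0.
Qed.

Lemma row'_neq0 (c : 'cV[F]_D.+1) : c != c j0 0 *: nu -> row' j0 (c - c j0 0 *: nu) != 0.
Proof.
apply: contraNneq => h; rewrite -subr_eq0; apply/eqP/colP => k.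
case: (unliftP j0 k) => [k' ->|->]; last by rewrite !mxE nu1 mulr1 subrr.
by move/colP/(_ k'): h; rewrite !mxE.
Qed.

Variables (M : 'M[F]_D.+1) (i : 'I_D.+1).
Hypothesis uM : M \in unitmx.
Hypothesis colM : col i (invmx M) = invmx M j0 i *: nu.

Lemma facet_lam_neq0 : invmx M j0 i != 0.
Proof.
by apply: contraTneq (col_invmx_neq0 i uM) => h; rewrite colM h scale0r eqxx.
Qed.

Lemma facet_unit : row' i (col' j0 M) \in unitmx.
Proof.
rewrite unitmxE unitfE -normr_eq0 det_minor // mulf_neq0 ?normr_eq0 //.
  exact: facet_lam_neq0.
by rewrite -unitfE -unitmxE.
Qed.

(** The generators of the facet are orthogonal to nu, so subtracting a multiple of nu from u keeps
    its value 1 on them: the normalisation by u passes to facets. *)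
Lemma facet_const u : M *m u = const_mx 1 ->
  row' i (col' j0 M) *m row' j0 (u - u j0 0 *: nu) = const_mx 1.
Proof.
move=> Mu.
have Mnu k : k != i -> (M *m nu) k 0 = 0.
  move=> ki; have := mulmx_col_invmx i uM.
  rewrite colM => /colP/(_ k); rewrite -scalemxAr !mxE (negbTE ki) => /eqP.
  by rewrite mulf_eq0 (negbTE facet_lam_neq0) => /eqP.
apply/colP => k; have := congr1 (fun A : 'cV_ _ => A (lift i k) 0) Mu.
have := Mnu (lift i k); rewrite eq_sym neq_lift => /(_ isT).
rewrite !mxE !sum_lift nu1 mulr1 => h1 h2.
rewrite -h2; under eq_bigr do rewrite !mxE mulrBr.
rewrite sumrB addrC; congr (_ + _).
under eq_bigr do rewrite mulrCA.
by rewrite -mulr_sumr -mulrN mulrC; congr (_ * _); apply/esym/eqP; rewrite -addr_eq0 h1.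
Qed.

Lemma cone_coord_lift_i y : cone_coord M (lift_pt y) 0 i = 0.
Proof. by rewrite cone_coordE colM -scalemxAr mxE lift_pt_nu mulr0. Qed.

Lemma cone_coord_facet y k :
  cone_coord (row' i (col' j0 M)) y 0 k = cone_coord M (lift_pt y) 0 (lift i k).
Proof.
suff : col' i (cone_coord M (lift_pt y)) *m row' i (col' j0 M) = y.
  move/(congr1 (mulmx^~ (invmx (row' i (col' j0 M))))).
  by rewrite mulmxK ?facet_unit // => /rowP/(_ k); rewrite /cone_coord => <-; rewrite mxE.
rewrite -[RHS]lift_pt_col'.
set c := cone_coord M _.
have -> : lift_pt y = c *m M by rewrite /c /cone_coord mulmxKV.
apply/rowP => l; rewrite !mxE.
rewrite (bigD1 i) //= cone_coord_lift_i mul0r add0r big_neq_lift.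
by apply: eq_bigr => k' _; rewrite !mxE.
Qed.
End Facet.

Lemma avoidsP D (Hs : seq 'cV[F]_D) x :
  reflect (forall c, c \in Hs -> (x *m c) 0 0 != 0) (avoids Hs x).
Proof. exact: allP. Qed.

Lemma big_allpairs2 (I J : Type) (r : seq I) (t : seq J) (P : I -> J -> bool)
    (K : Type) (f : I -> J -> K) (G : K -> F) :
  \sum_(k <- [seq f p.1 p.2 | p <- [seq p <- [seq (i, j) | i <- r, j <- t] | P p.1 p.2]]) G k
  = \sum_(i <- r) \sum_(j <- t | P i j) G (f i j).
Proof. by rewrite big_map big_filter big_mkcond /= big_allpairs; apply: eq_bigr => i _; rewrite [RHS]big_mkcond. Qed.

(* For small e, moving a generic point of the hyperplane by e across it changes
   its position relative to M only if M has a facet in the hyperplane. *)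
Lemma jump D (M : 'M[F]_D.+1) (nu : 'cV_D.+1) j0 (y : 'rV_D) e :
  nu j0 0 = 1 -> M \in unitmx -> 0 < e ->
  (forall i, col i (invmx M) != invmx M j0 i *: nu ->
     cone_coord M (lift_pt nu j0 y) 0 i != 0 /\
     e * `|invmx M j0 i| < `|cone_coord M (lift_pt nu j0 y) 0 i|) ->
  (in_cone M (lift_pt nu j0 y + e *: delta_mx 0 j0))%:R
  - (in_cone M (lift_pt nu j0 y - e *: delta_mx 0 j0))%:R =
  \sum_(i | col i (invmx M) == invmx M j0 i *: nu)
     Num.sg (invmx M j0 i) * (in_cone (row' i (col' j0 M)) y)%:R :> F.
Proof.
move=> nu1 uM e0 gen; set x := lift_pt nu j0 y.
have cE i (t : F) : cone_coord M (x + t *: delta_mx 0 j0) 0 i = cone_coord M x 0 i + t * invmx M j0 i.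
  by rewrite !cone_coordE mulmxDl -scalemxAl -rowE !mxE.
have cN i : col i (invmx M) != invmx M j0 i *: nu -> forall t, `|t| = e ->
    (0 <= cone_coord M (x + t *: delta_mx 0 j0) 0 i) = (0 <= cone_coord M x 0 i).
  move=> /gen[c0 ce] t te; rewrite cE.
  by rewrite perturb_ge0 // normrM te.
have eN : `|- e| = e by rewrite normrN gtr0_norm.
have eP : `|e| = e by rewrite gtr0_norm.
rewrite -scaleNr.
case: (pickP (fun i => col i (invmx M) == invmx M j0 i *: nu)) => [i Hi|no].
  have Mi := eqP Hi; have lam0 := facet_lam_neq0 uM Mi.
  (* Only one facet can lie in the hyperplane, since the columns of the inverse are independent. *)
  have uniq_i k : k != i -> col k (invmx M) != invmx M j0 k *: nu.
    move=> ki; apply/negP => /eqP Mk.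
    have : M *m (invmx M j0 i *: col k (invmx M) - invmx M j0 k *: col i (invmx M)) = 0.
      by rewrite Mk Mi !scalerA mulrC subrr mulmx0.
    rewrite mulmxBr -!scalemxAr !mulmx_col_invmx // => /colP/(_ k).
    rewrite !mxE eqxx (negbTE ki) !eqxx /= mulr0 subr0 mulr1 => h.
    by rewrite h eqxx in lam0.
  rewrite (big_pred1 i) => [|k]; last first.
    by apply/idP/eqP => [Hk|->//]; apply: contraTeq Hk => /uniq_i.
  have xi : cone_coord M x 0 i = 0 by rewrite (cone_coord_lift_i _ Mi).
  have inE t : `|t| = e -> in_cone M (x + t *: delta_mx 0 j0) =
      (0 <= t * invmx M j0 i) && in_cone (row' i (col' j0 M)) y.
    move=> te; apply/forallP/andP => [h|[h1 /forallP h2] k].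
      have := h i; rewrite cE xi add0r => ->; split=> //; apply/forallP => k.
      rewrite (cone_coord_facet nu1 uM Mi) -(cN _ _ t te) //; apply: uniq_i.
      by rewrite eq_sym neq_lift.
    case: (unliftP i k) => [k' ->|->]; last by rewrite cE xi add0r.
    rewrite cN //; last by apply: uniq_i; rewrite eq_sym neq_lift.
    by rewrite -(cone_coord_facet nu1 uM Mi).
  rewrite !inE // mulNr oppr_ge0 pmulr_rge0 // pmulr_rle0 //.
  by case: in_cone; case: (sgrP (invmx M j0 i)) lam0; rewrite /= ?eqxx // ?subr0 ?sub0r ?mulr0 ?mulr1 ?mul0r ?subrr.
rewrite big_pred0 //; apply/eqP; rewrite subr_eq0; apply/eqP; congr (_%:R).
congr (nat_of_bool _); apply/eq_forallb => i; rewrite !cN ?no //.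
Qed.

(** The vector u puts all generators in one affine hyperplane, so that each cone stands for a
    simplex there, with volume proportional to [|\det|]. Otherwise rescaling a generator would
    change the determinant but not the cone. *)
Definition cone_relation_prop D := forall (S : seq (F * 'M[F]_D)) (u : 'cV_D) Hs,
  (forall s, s \in S -> s.2 \in unitmx /\ s.2 *m u = const_mx 1) ->
  (forall c, c \in Hs -> c != 0) ->
  (forall x, avoids Hs x -> \sum_(s <- S) s.1 * (in_cone s.2 x)%:R = 0) ->
  \sum_(s <- S) s.1 * `|\det s.2| = 0.

(** Subtracting the relation at two points just across the hyperplane of nu leaves a relation
    between the facets in this hyperplane, signed by the side on which their cones lie. The
    induction hypothesis applies to it, and [det_minor] turns its minors into determinants of the
    original cones. *)
Lemma facet_relation D (S : seq (F * 'M[F]_D.+1)) (u : 'cV_D.+1) Hs (nu : 'cV_D.+1) j0 :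
  cone_relation_prop D -> nu j0 0 = 1 ->
  (forall s, s \in S -> s.2 \in unitmx /\ s.2 *m u = const_mx 1) ->
  (forall c, c \in Hs -> c != 0) ->
  (forall x, avoids Hs x -> \sum_(s <- S) s.1 * (in_cone s.2 x)%:R = 0) ->
  \sum_(s <- S) \sum_(i | col i (invmx s.2) == invmx s.2 j0 i *: nu)
     s.1 * invmx s.2 j0 i * `|\det s.2| = 0.
Proof.
move=> IH nu1 HS HHs Hx.
pose P (s : F * 'M[F]_D.+1) i := col i (invmx s.2) == invmx s.2 j0 i *: nu.
pose f (s : F * 'M[F]_D.+1) i := (s.1 * Num.sg (invmx s.2 j0 i), row' i (col' j0 s.2)).
pose S' := [seq f p.1 p.2 | p <- [seq p <- [seq (s, i) | s <- S, i <- index_enum 'I_D.+1] | P p.1 p.2]].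
(* The crossing must meet no other wall, be it from Hs or from a cone. Multiples of nu restrict to 0
   on the hyperplane and are left out of Hs'. *)
pose cols := Hs ++ [seq col i (invmx s.2) | s <- S, i <- enum 'I_D.+1].
pose Hs' := [seq row' j0 (c - c j0 0 *: nu) | c : 'cV_D.+1 <- cols & c != c j0 0 *: nu].
have := IH S' (row' j0 (u - u j0 0 *: nu)) Hs'.
rewrite /S' !big_allpairs2 /= => IHS; rewrite -[RHS]IHS.
- rewrite [LHS]big_seq [RHS]big_seq; apply: eq_bigr => s /HS[us _].
  apply: eq_bigr => i _; rewrite det_minor //.
  by rewrite [in LHS](numEsg (invmx s.2 j0 i)) !mulrA.
- move=> s' /mapP[[s i]]; rewrite mem_filter /= => /andP[/eqP Ps].
  move=> /allpairsP[[s2 i2] /= [/HS[us su] _ [es ei]]] -> /=.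
  by subst s2 i2; split; [exact: facet_unit us Ps|exact: facet_const].
- by move=> c' /mapP[c]; rewrite mem_filter => /andP[cn _] ->; apply: row'_neq0.
move=> y /avoidsP Hy; rewrite big_allpairs2 /=; set x := lift_pt nu j0 y.
have [e e0 He] := small_perturbation [seq ((x *m c) 0 0, c j0 0) | c : 'cV_D.+1 <- cols].
have xc c : c \in cols -> c != c j0 0 *: nu ->
    (x *m c) 0 0 != 0 /\ e * `|c j0 0| < `|(x *m c) 0 0|.
  move=> cc cn; have xc0 : (x *m c) 0 0 != 0.
    by rewrite lift_pt_mul //; apply: Hy; apply: map_f; rewrite mem_filter cn.
  by split=> //; apply: (He (_, _)) => //; apply/mapP; exists c.
(* Walls proportional to nu contain x and are left by the move; all others are too far away to be
   reached. *)
have av t : `|t| = e -> avoids Hs (x + t *: delta_mx 0 j0).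
  move=> te; apply/avoidsP => c cH; rewrite mulmxDl -scalemxAl -rowE !mxE.
  have [cn|cn] := eqVneq c (c j0 0 *: nu).
    have cj : c j0 0 != 0.
      by apply: contraTneq (HHs _ cH) => h; rewrite cn h scale0r eqxx.
    have := lift_pt_nu nu1 y; rewrite -/x => xnu.
    have : (x *m c) 0 0 = 0 by rewrite cn -scalemxAr mxE xnu mulr0.
    by rewrite mxE => ->; rewrite add0r mulf_neq0 // -normr_eq0 te gt_eqF.
  have [|h1 h2] := xc c _ cn; first by rewrite mem_cat cH.
  by rewrite mxE in h1 h2; rewrite perturb_neq0 // normrM te.
have /Hx h1 := av e (gtr0_norm e0).
have /Hx h2 : avoids Hs (x - e *: delta_mx 0 j0).
  by rewrite -scaleNr av // normrN gtr0_norm.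
rewrite -[RHS](subrr 0) -[X in _ = X - _]h1 -[X in _ = _ - X]h2 -sumrB.
rewrite [LHS]big_seq [RHS]big_seq; apply: eq_bigr => s Ss; have [us _] := HS _ Ss.
rewrite -mulrBr (jump nu1 us e0) => [|i cn].
  by rewrite mulr_sumr; apply: eq_bigr => i _; rewrite mulrA.
have cc : col i (invmx s.2) \in cols.
  rewrite mem_cat; apply/orP; right; apply/allpairsP; exists (s, i).
  by rewrite mem_enum.
by have := xc _ cc; rewrite -cone_coordE [col i _ j0 0]mxE; apply.
Qed.

(** Each simplex is a signed sum of pyramids over its facets with a common apex w. The pyramid over
    facet i has volume [|\det|] times the i-th coordinate of w, and these coordinates sum to 1
    because [w *m u = 1]. Grouped by hyperplane, the pyramids give multiples of the sums that vanish
    by [facet_relation]. *)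
Lemma cone_relation D : cone_relation_prop D.
Proof.
elim: D => [|D IH] S u Hs HS HHs Hx.
  (* In dimension 0 there is no nonzero normal, every cone contains the origin and every determinant
     is 1, so the two relations coincide. *)
  have : avoids Hs 0.
    by apply/avoidsP => c /HHs/negP; case; apply/eqP/colP; case.
  move/Hx => h; rewrite -[RHS]h; apply: eq_bigr => s _.
  rewrite det_mx00 normr1 (_ : in_cone _ _ = true) //; apply/forallP; case=> //.
have [->|/hasP[s0 Ss0 _]] : S = [::] \/ has predT S by case: (S); [left|right].
  by rewrite big_nil.
have [w wu] : exists w : 'rV_D.+1, w *m u = 1.
  have [_ s0u] := HS _ Ss0; exists (row ord0 s0.2); rewrite -row_mul s0u.
  by apply/matrixP => i j; rewrite !mxE !ord1 eqxx.
pose N := undup [seq normal_of (col i (invmx s.2)) | s <- S, i <- enum 'I_D.+1].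
have NP nu : nu \in N -> nu (pivot nu) 0 = 1.
  rewrite mem_undup => /allpairsP[[s i] /= [/HS[us _] _ ->]].
  by rewrite normal_of_pivot // col_invmx_neq0.
(* Elements of N have pivot entry 1, so proportionality to nu amounts to equality of normalised
   columns, and each facet is counted for a single nu. *)
have E s i nu : s \in S -> nu \in N ->
    (col i (invmx s.2) == invmx s.2 (pivot nu) i *: nu)
    = (normal_of (col i (invmx s.2)) == nu).
  move=> /HS[us _] Nnu; have c0 := col_invmx_neq0 i us.
  apply/eqP/eqP => [h|/(normal_of_eq c0)]; last by rewrite !mxE.
  have l0 : invmx s.2 (pivot nu) i != 0.
    by apply: contraTneq c0 => h'; rewrite h h' scale0r eqxx.
  have nu0 : nu != 0.
    by apply: contraTneq c0 => h'; rewrite h h' scaler0 eqxx.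
  by rewrite h normal_ofZ // /normal_of NP // invr1 scale1r.
(* The weight [w *m nu] is the height of the apex above the hyperplane of nu. *)
transitivity (\sum_(nu <- N) (w *m nu) 0 0 *
   \sum_(s <- S) \sum_(i | col i (invmx s.2) == invmx s.2 (pivot nu) i *: nu)
     s.1 * invmx s.2 (pivot nu) i * `|\det s.2|); last first.
  rewrite big_seq big1 // => nu /NP nu1.
  by rewrite (facet_relation IH nu1 HS HHs Hx) mulr0.
under [in RHS]eq_bigr do rewrite mulr_sumr.
rewrite exchange_big /= [LHS]big_seq [RHS]big_seq; apply: eq_bigr => s Ss.
have [us su] := HS _ Ss.
transitivity (\sum_i s.1 * (w *m col i (invmx s.2)) 0 0 * `|\det s.2|).
  rewrite -mulr_suml -mulr_sumr; congr (_ * _); rewrite -[LHS]mulr1; congr (_ * _).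
  have : (w *m invmx s.2 *m (const_mx 1 : 'cV_D.+1)) 0 0 = 1.
    by rewrite -su mulmxA mulmxKV // wu mxE eqxx.
  rewrite mxE => <-; apply: eq_bigr => i _.
  by rewrite -cone_coordE !mxE mulr1; apply: eq_bigr.
transitivity (\sum_i \sum_(nu <- N | normal_of (col i (invmx s.2)) == nu)
     (w *m nu) 0 0 * (s.1 * invmx s.2 (pivot nu) i * `|\det s.2|)).
  apply: eq_bigr => i _; set nu := normal_of _.
  have Nnu : nu \in N.
    by rewrite mem_undup; apply/allpairsP; exists (s, i); rewrite mem_enum.
  rewrite -big_filter (_ : [seq _ <- N | _] = [:: nu]); last first.
    by rewrite (eq_filter (a2 := pred1 nu)) ?filter_pred1_uniq ?undup_uniq // => x; rewrite /= eq_sym.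
  have -> : col i (invmx s.2) = invmx s.2 (pivot nu) i *: nu by apply/eqP; rewrite E.
  by rewrite big_seq1 -scalemxAr mxE; ring.
rewrite [LHS](exchange_big_dep predT) //= [LHS]big_seq [RHS]big_seq.
apply: eq_bigr => nu Nnu; rewrite mulr_sumr.
by apply: eq_big => [i|i _]; rewrite ?E.
Qed.



(** * Truncated cones as simplices, one dimension higher *)

Section Homogenize.
Variables (D : nat) (h : 'rV[F]_D -> F).

Definition unscaled (M : 'M[F]_D) : 'M[F]_D :=
  diag_mx (\row_i (h (row i M))^-1) *m M.
(** The rows are the vertices of the truncated cone, namely 0 and the generators scaled to h = 1,
    each preceded by a coordinate 1. This first coordinate serves as the functional u of
    [cone_relation]. *)
Definition simplex_mx (M : 'M[F]_D) : 'M[F]_(1 + D) :=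
  block_mx 1%:M 0 (const_mx 1) (unscaled M).

Hypothesis (M : 'M[F]_D).
Hypothesis uM : M \in unitmx.
Hypothesis hM : forall i, 0 < h (row i M).

Lemma det_simplex_mx : \det (simplex_mx M) = \det M / \prod_i h (row i M).
Proof.
rewrite det_lblock det1 mul1r det_mulmx det_diag mulrC -prodfV.
by congr (_ * _); apply: eq_bigr => i _; rewrite mxE.
Qed.

Lemma prod_row_gt0 : 0 < \prod_i h (row i M).
Proof. by apply: prodr_gt0 => i _. Qed.

Lemma simplex_mx_unit : simplex_mx M \in unitmx.
Proof.
by rewrite unitmxE det_simplex_mx unitrM unitrV -unitmxE uM unitfE gt_eqF // prod_row_gt0.
Qed.

(** The coordinate at the vertex 0 is r minus the sum of the h-weighted coordinates of y, and this
    sum is h y as soon as y lies in the cone. *)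
Lemma in_cone_simplex_mx r y :
  (in_cone M y -> h y = \sum_i cone_coord M y 0 i * h (row i M)) ->
  in_cone (simplex_mx M) (row_mx r y) = in_cone M y && (h y <= r 0 0).
Proof.
pose c : 'rV_D := \row_i (cone_coord M y 0 i * h (row i M)) => Hh.
have ci i : c 0 i = cone_coord M y 0 i * h (row i M) by rewrite mxE.
have -> : in_cone (simplex_mx M) (row_mx r y) =
    [forall i, 0 <= (row_mx (r - const_mx (\sum_i c 0 i)) c : 'rV_(1 + D)) 0 i].
  apply: eq_forallb => i; congr (_ <= _); suff -> : row_mx r y =
      row_mx (r - const_mx (\sum_i c 0 i)) c *m simplex_mx M :> 'rV_(1 + D).
    by rewrite /cone_coord mulmxK // simplex_mx_unit.
  rewrite mul_row_block mulmx1 mulmx0 add0r; congr row_mx.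
    apply/rowP => j; rewrite !mxE ord1 -addrA [- _ + _](_ : _ = 0) ?addr0 //.
    by apply/eqP; rewrite addrC subr_eq0; apply/eqP/eq_bigr => k _; rewrite !mxE mulr1.
  rewrite mulmxA -[y in LHS](mulmxKV uM); congr (_ *m _); apply/rowP => j.
  by rewrite mul_mx_diag !mxE mulfK ?gt_eqF.
have cE : in_cone M y = [forall i, 0 <= c 0 i].
  by apply: eq_forallb => i; rewrite ci pmulr_lge0.
have sE : in_cone M y -> \sum_i c 0 i = h y.
  by move=> /Hh ->; apply: eq_bigr => i _; rewrite ci.
apply/forallP/andP => [H|[cM hr] i].
  have cM : in_cone M y.
    by rewrite cE; apply/forallP => i; have := H (rshift 1 i); rewrite row_mxEr.
  split=> //; have := H (lshift D 0); rewrite row_mxEl mxE [X in _ + X]mxE [X in - X]mxE.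
  by rewrite sE // subr_ge0.
case: (split_ordP i) => j ->; last first.
  by rewrite row_mxEr; move: cM; rewrite cE => /forallP.
by rewrite row_mxEl mxE [X in _ + X]mxE [X in - X]mxE ord1 sE // subr_ge0.
Qed.
End Homogenize.

(* Simplicial cones cut off by h <= 1 are simplices with a vertex at 0, to
   which [cone_relation] applies in one dimension higher. *)
Theorem cone_volume_eq D (T1 T2 : seq 'M[F]_D) (h : 'rV[F]_D -> F) (Hs : seq 'cV[F]_D) :
  (forall M, M \in T1 ++ T2 -> [/\ M \in unitmx, forall i, 0 < h (row i M)
    & forall x, in_cone M x -> h x = \sum_i cone_coord M x 0 i * h (row i M)]) ->
  (forall c, c \in Hs -> c != 0) ->
  (forall x, avoids Hs x ->
     \sum_(M <- T1) (in_cone M x)%:R = \sum_(M <- T2) (in_cone M x)%:R :> F) ->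
  \sum_(M <- T1) `|\det M| / \prod_i h (row i M) =
  \sum_(M <- T2) `|\det M| / \prod_i h (row i M).
Proof.
move=> HT HHs Hx.
pose S := [seq ((1 : F), simplex_mx h M) | M <- T1] ++
          [seq ((-1 : F), simplex_mx h M) | M <- T2].
have := @cone_relation _ S (col_mx 1%:M 0) [seq col_mx 0 c | c <- Hs].
rewrite /S !big_cat /= !big_map /=.
under eq_bigr do rewrite mul1r.
under [X in _ + X]eq_bigr do rewrite mulN1r.
rewrite sumrN => H; apply/eqP; rewrite -subr_eq0; apply/eqP; rewrite -[RHS]H.
- have E M : M \in T1 ++ T2 ->
      `|\det M| / \prod_i h (row i M) = `|\det (simplex_mx h M)|.
    move=> /HT[_ hM _]; rewrite det_simplex_mx normrM normfV.
    by rewrite (gtr0_norm (prod_row_gt0 _)).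
  congr (_ - _); rewrite [LHS]big_seq [RHS]big_seq; apply: eq_bigr => M MT.
    by rewrite E // mem_cat MT.
  by rewrite E // mem_cat MT orbT.
- move=> s; rewrite mem_cat => sS.
  have {s sS}[a [M MT ->]] : exists a, exists2 M, M \in T1 ++ T2 & s = (a, simplex_mx h M).
    case/orP: sS => /mapP[M MT ->]; [exists 1|exists (-1)]; exists M => //.
      by rewrite mem_cat MT.
    by rewrite mem_cat MT orbT.
  have [uM hM _] := HT _ MT; split; first exact: simplex_mx_unit.
  rewrite /simplex_mx mul_block_col !mulmx1 !mulmx0 !addr0.
  by apply/colP => i; case: (split_ordP i) => j ->; rewrite ?col_mxEu ?col_mxEd !mxE ?ord1.
- move=> c /mapP[c' cH ->]; apply: contraNneq (HHs _ cH) => h0.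
  by apply/eqP/colP => i; have /colP/(_ (rshift 1 i)) := h0; rewrite col_mxEd !mxE.
move=> x; rewrite -[x]hsubmxK; set r := lsubmx x; set y := rsubmx x => Av.
have {}Av : avoids Hs y.
  apply/avoidsP => c cH; have /avoidsP/(_ (col_mx 0 c)) := Av.
  by rewrite mul_row_col mulmx0 add0r; apply; rewrite map_f.
rewrite big_cat !big_map /=.
under eq_bigr do rewrite mul1r.
under [X in _ + X]eq_bigr do rewrite mulN1r.
rewrite sumrN.
(* The truncation condition h y <= r is the same for all cones, so it factors out of the sums. *)
have E (T : seq 'M[F]_D) : {subset T <= T1 ++ T2} ->
   \sum_(M <- T) (in_cone (simplex_mx h M) (row_mx r y))%:R =
   (\sum_(M <- T) (in_cone M y)%:R) * (h y <= r 0 0)%R%:R :> F.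
  move=> sT; rewrite mulr_suml [LHS]big_seq [RHS]big_seq; apply: eq_bigr => M MT.
  have [uM hM hE] := HT _ (sT _ MT).
  rewrite (in_cone_simplex_mx uM hM _ (hE y)).
  by case: in_cone; rewrite ?mul1r ?mul0r.
rewrite !E ?Hx ?subrr // => M MT; rewrite mem_cat MT ?orbT //.
Qed.

End ConeRelation.

(** * Values of rational functions *)

Section FracVal.
Variables (A : idomainType) (K : fieldType) (phi : {rmorphism A -> K}).

(** A relation rather than a function, so that no default value at poles intervenes. An arbitrary
    morphism phi covers both evaluation at a point and substitution of polynomials. *)
Definition frac_val (f : {fraction A}) (r : K) : Prop :=
  exists a b, [/\ phi b != 0, f = tofrac a / tofrac b & r = phi a / phi b].

Lemma neq0_of_morph b : phi b != 0 -> b != 0.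
Proof. by apply: contraNneq => ->; rewrite rmorph0. Qed.

Lemma frac_eqP (a b c e : A) : b != 0 -> e != 0 ->
  (tofrac a / tofrac b == tofrac c / tofrac e) = (a * e == c * b).
Proof.
move=> b0 e0; rewrite -(tofrac_eq (a * e)) !rmorphM /=.
by rewrite eqr_div // tofrac_eq0.
Qed.

Lemma frac_val_uniq f r r' : frac_val f r -> frac_val f r' -> r = r'.
Proof.
move=> [a [b [b0 -> ->]]] [c [e [e0 + ->]]] => /eqP.
rewrite frac_eqP ?neq0_of_morph // => /eqP/(congr1 phi); rewrite !rmorphM => h.
by apply/eqP; rewrite eqr_div // h.
Qed.

Lemma frac_val_div a b : phi b != 0 ->
  frac_val (tofrac a / tofrac b) (phi a / phi b).
Proof. by move=> b0; exists a, b. Qed.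

Lemma frac_val0 : frac_val 0 0.
Proof. by exists 0, 1; rewrite !rmorph0 !mul0r rmorph1 oner_eq0. Qed.

Lemma frac_valD f g r s : frac_val f r -> frac_val g s -> frac_val (f + g) (r + s).
Proof.
move=> [a [b [b0 -> ->]]] [c [e [e0 -> ->]]].
exists (a * e + c * b), (b * e); rewrite !rmorphD !rmorphM mulf_neq0 //.
by split; rewrite // addf_div // tofrac_eq0 neq0_of_morph.
Qed.

Lemma frac_valN f r : frac_val f r -> frac_val (- f) (- r).
Proof.
by move=> [a [b [b0 -> ->]]]; exists (- a), b; rewrite !rmorphN !mulNr.
Qed.

Lemma frac_val_sum (I : eqType) (s : seq I) (P : pred I) (F : I -> {fraction A}) (G : I -> K) :
  (forall i, i \in s -> P i -> frac_val (F i) (G i)) ->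
  frac_val (\sum_(i <- s | P i) F i) (\sum_(i <- s | P i) G i).
Proof.
elim: s => [|i s IH] H; first by rewrite !big_nil; exact: frac_val0.
rewrite !big_cons; have IHs : frac_val (\sum_(j <- s | P j) F j) (\sum_(j <- s | P j) G j).
  by apply: IH => j js; apply: H; rewrite inE js orbT.
by case: ifP => // Pi; apply: frac_valD IHs; apply: H; rewrite // mem_head.
Qed.

Lemma frac_val_term (I : finType) a (F : I -> A) :
  (forall i, phi (F i) != 0) ->
  frac_val (tofrac a / \prod_i tofrac (F i)) (phi a / \prod_i phi (F i)).
Proof.
move=> F0; rewrite -!rmorph_prod; apply: frac_val_div.
by rewrite rmorph_prod; apply/prodf_neq0 => i _.
Qed.
End FracVal.

Section Values.
Variables (R : realType) (d : nat).

Lemma rat_evalE (f : 'RF[R]_d) (z : 'rV[R]_d) r :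
  frac_val (meval (z 0)) f r -> rat_eval f z = r.
Proof.
move=> fr; rewrite /rat_eval; apply: xget_unique => // r' fr'.
exact: (frac_val_uniq fr' fr).
Qed.

(** Composition with [tofrac] makes the target a field, as [frac_val] requires. *)
Definition subst_val e (l : 'I_d -> 'RX[R]_e) :=
  frac_val (@FracField.tofrac _ \o comp_mpoly (mktuple l) : {rmorphism 'RX[R]_d -> 'RF[R]_e}).

Lemma rat_substE e (l : 'I_d -> 'RX[R]_e) (f : 'RF[R]_d) g :
  subst_val l f g -> rat_subst l f = g.
Proof.
move=> fg; rewrite /rat_subst; apply: xget_unique => /=.
  by case: fg => a [b [/= b0 -> ->]]; exists a, b; split=> //; rewrite -tofrac_eq0.
move=> g' [a [b [b0 fE gE]]]; apply: (frac_val_uniq (phi := (@FracField.tofrac _ \o comp_mpoly (mktuple l) : {rmorphism 'RX[R]_d -> 'RF[R]_e})) (f := f)) => //.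
by exists a, b; split=> //=; rewrite tofrac_eq0.
Qed.

Definition line_poly (z w : 'rV[R]_d) : 'RX[R]_d -> {poly R} :=
  mmap polyC (fun i => (z 0 i)%:P + w 0 i *: 'X).

Lemma line_poly_horner z w f t : (line_poly z w f).[t] = meval ((z + t *: w) 0) f.
Proof.
rewrite /line_poly /meval /mmap horner_sum; apply: eq_bigr => m _.
rewrite hornerM hornerC /=; congr (_ * _); rewrite /mmap1 horner_prod.
by apply: eq_bigr => i _; rewrite horner_exp !hornerE !mxE mulrC.
Qed.

Lemma poly_eq0_infinite (q : {poly R}) (e : R) : 0 < e ->
  (forall t, 0 < t < e -> q.[t] = 0) -> q = 0.
Proof.
move=> e0 H; apply/eqP/negPn/negP => q0.
(* The offset 2 keeps every e / (k + 2) strictly below e. *)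
pose s := [seq e / k.+2%:R | k <- iota 0 (size q)].
have rs : all (root q) s.
  apply/allP => t /mapP[k _ ->]; apply/rootP/H.
  by rewrite divr_gt0 // ltr_pdivrMr // ltr_pMr // ltr1n.
have us : uniq s.
  rewrite map_inj_uniq ?iota_uniq // => j k /(mulfI (lt0r_neq0 e0))/invr_inj/eqP.
  by rewrite eqr_nat => /eqP[].
by have := max_poly_roots q0 rs us; rewrite size_map size_iota ltnn.
Qed.

Lemma line_poly_deriv z i f :
  (line_poly z (delta_mx 0 i) f)^`() = line_poly z (delta_mx 0 i) (mderiv i f).
Proof.
set L := line_poly z _.
have LM a b : L (a * b) = L a * L b by exact: (rmorphM (mmap polyC _)).
have prodP a b : (L a)^`() = L (mderiv i a) -> (L b)^`() = L (mderiv i b) ->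
    (L (a * b))^`() = L (mderiv i (a * b)).
  move=> ha hb; rewrite mderivM LM derivM ha hb -!LM.
  by rewrite /L /line_poly -mmapD.
have L1 : (L 1)^`() = L (mderiv i 1).
  rewrite -mpolyC1 mderivC /L /line_poly mmap0 mmapC derivC //.
have X1 j : (L (mpolyX R (mnm1 j)))^`() = L (mderiv i (mpolyX R (mnm1 j))).
  rewrite mderivX /L /line_poly mmapX mmap1U mmapZ mmapX !mxE mnm1E.
  rewrite derivD derivC derivZ derivX add0r eqxx /= alg_polyC.
  have [->|ij] := eqVneq j i; last by rewrite mul0r.
  by rewrite (_ : mnm_sub _ _ = mnm0) ?mmap11 ?mulr1 //; apply/mnmP => k; rewrite mnmBE subnn mnm0E.
have Xm m : (L (mpolyX R m))^`() = L (mderiv i (mpolyX R m)).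
  rewrite mpolyXE_id; elim/big_ind: _ => // j _.
  elim: (m j) => [|k IH]; first by rewrite expr0.
  by rewrite exprS; apply: prodP.
elim/mpolyind: f => [|c m f _ _ IH].
  by rewrite mderiv0 /L /line_poly mmap0 deriv0.
rewrite mderivD mderivZ /L /line_poly !mmapD !mmapZ derivD -/(line_poly _ _ _).
by rewrite !mul_polyC derivZ (Xm m) IH.
Qed.

(** Restricting to coordinate lines shows that all iterated partial derivatives vanish everywhere.
    The derivative of multi-order m at 0 is the coefficient of m times a product of factorials,
    which is nonzero in characteristic 0. *)
Lemma mpoly_vanish (f : 'RX[R]_d) : (forall z, meval z f = 0) -> f = 0.
Proof.
move=> Hf.
have Hd m : forall z, meval z (mderivm m f) = 0.
  rewrite mderivm_foldr; elim: (flatten _) => [|i s IH] //= z.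
  set g := foldr _ _ _ in IH *.
  pose z' : 'rV[R]_d := \row_j z j.
  have L0 : line_poly z' (delta_mx 0 i) g = 0.
    by apply: (@poly_eq0_infinite _ 1) => // t _; rewrite line_poly_horner IH.
  have := line_poly_deriv z' i g; rewrite L0 deriv0 => /(congr1 (horner^~ 0)).
  rewrite horner0 line_poly_horner scale0r addr0 => /esym h; rewrite -[RHS]h.
  by apply: meval_eq => j; rewrite mxE.
apply/mpolyP => m; rewrite mcoeff0.
have m0E p : meval (fun=> 0) p = mcoeff mnm0 p :> R.
  rewrite [p]mpolyE !raddf_sum /=; apply: eq_bigr => k _.
  rewrite mevalZ mcoeffZ mcoeffX mevalX; congr (_ * _).
  have [->|k0] := eqVneq k mnm0; first by rewrite big1 // => j _; rewrite mnm0E expr0.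
  have /existsP[j kj] : [exists j, k j != 0%N].
    apply: contraNT k0 => /existsPn h; apply/eqP/mnmP => j.
    by rewrite mnm0E; apply/eqP/negPn/h.
  by rewrite (bigD1 j) //= expr0n (negbTE kj) mul0r.
have := Hd m (fun=> 0); rewrite m0E mcoeff_mderivm addm0 => /eqP.
rewrite mulrn_eq0 => /orP[|/eqP//]; apply: contraTeq => _.
by rewrite -lt0n; apply: prodn_gt0 => j; rewrite ffactnn fact_gt0.
Qed.


Lemma dotDr (u v w : 'rV[R]_d) : dot u (v + w) = dot u v + dot u w.
Proof. by rewrite -big_split; apply: eq_bigr => i _; rewrite !mxE mulrDr. Qed.

Lemma dotZr (u v : 'rV[R]_d) a : dot u (a *: v) = a * dot u v.
Proof. by rewrite mulr_sumr; apply: eq_bigr => i _; rewrite !mxE mulrCA. Qed.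

(* On every line through y, f vanishes near y and hence everywhere. *)
Lemma mpoly_vanish_region (f : 'RX[R]_d) (L : seq (R * 'rV[R]_d)) (y : 'rV[R]_d) :
  (forall a, a \in L -> 0 < a.1 + dot a.2 y) ->
  (forall z : 'rV[R]_d, (forall a, a \in L -> 0 < a.1 + dot a.2 z) ->
     meval (z 0) f = 0) ->
  f = 0.
Proof.
move=> Ly Hf; apply: mpoly_vanish => z0; pose z : 'rV[R]_d := \row_i z0 i.
have [e e0 He] := small_perturbation [seq (a.1 + dot a.2 y, dot a.2 (z - y)) | a : R * 'rV[R]_d <- L].
have L0 : line_poly y (z - y) f = 0.
  apply: (poly_eq0_infinite e0) => t /andP[t0 te]; rewrite line_poly_horner.
  apply: Hf => a aL; rewrite dotDr dotZr addrA.
  have ay := Ly _ aL; have := He _ (map_f _ aL) => /=; rewrite gt_eqF // => /(_ isT).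
  rewrite (gtr0_norm ay) => h.
  have : `|t * dot a.2 (z - y)| < a.1 + dot a.2 y.
    by apply: le_lt_trans h; rewrite normrM ler_wpM2r // gtr0_norm // ltW.
  by rewrite ltr_norml => /andP[h1 _]; rewrite -ltrBlDl sub0r.
have := congr1 (horner^~ 1) L0; rewrite horner0 line_poly_horner scale1r addrC subrK => <-.
by apply: meval_eq => i; rewrite mxE.
Qed.

(** The fraction witnessing the value may change with z. Cross multiplication with one fixed
    representation a / b shows that a vanishes on the whole region. *)
Lemma frac_eq0_region (f : 'RF[R]_d) (L : seq (R * 'rV[R]_d)) (y : 'rV[R]_d) :
  (forall a, a \in L -> 0 < a.1 + dot a.2 y) ->
  (forall z : 'rV[R]_d, (forall a, a \in L -> 0 < a.1 + dot a.2 z) ->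
     frac_val (meval (z 0)) f 0) ->
  f = 0.
Proof.
move=> Ly Hf; have [a [b [b0 fE _]]] := Hf y Ly.
suff a0 : a = 0 by rewrite fE a0 rmorph0 mul0r.
apply: (mpoly_vanish_region Ly) => z /Hf[a' [b' [b'0 + h]]].
rewrite fE => /eqP; rewrite frac_eqP ?(neq0_of_morph b0) ?(neq0_of_morph b'0) //.
move=> /eqP/(congr1 (meval (z 0))); rewrite !mevalM => E.
have a'0 : meval (z 0) a' = 0.
  by move/esym/eqP: h; rewrite mulf_eq0 invr_eq0 (negbTE b'0) orbF => /eqP.
by move/eqP: E; rewrite a'0 mul0r mulf_eq0 (negbTE b'0) orbF => /eqP.
Qed.

End Values.

(** * Support functions and triangulations *)

Section Support.
Variables (R : realType) (d : nat).
Implicit Types (P Q F H : set 'rV[R]_d) (p u v y z : 'rV[R]_d).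

Lemma dotC u v : dot u v = dot v u.
Proof. by apply: eq_bigr => i _; rewrite mulrC. Qed.

Lemma dotDl u v w : dot (u + v) w = dot u w + dot v w :> R.
Proof. by rewrite dotC dotDr !(dotC w). Qed.

Lemma dotZl u v a : dot (a *: u) v = a * dot u v :> R.
Proof. by rewrite dotC dotZr dotC. Qed.

Lemma dotNr u v : dot u (- v) = - dot u v.
Proof. by rewrite -scaleN1r dotZr mulN1r. Qed.

Lemma dotNl u v : dot (- u) v = - dot u v.
Proof. by rewrite dotC dotNr dotC. Qed.

Lemma dot0r u : dot u 0 = 0 :> R.
Proof. by rewrite -(scale0r 0) dotZr mul0r. Qed.

Lemma dot_sumr (I : Type) (r : seq I) (P : pred I) (F : I -> 'rV[R]_d) u :
  dot u (\sum_(i <- r | P i) F i) = \sum_(i <- r | P i) dot u (F i).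
Proof. by elim/big_rec2: _ => [|i x y _ <-]; rewrite ?dot0r ?dotDr. Qed.

Lemma dot_mulmx k (c : 'rV[R]_k) (M : 'M[R]_(k, d)) u :
  dot (c *m M) u = \sum_i c 0 i * dot (row i M) u.
Proof.
rewrite dotC mulmx_sum_row dot_sumr; apply: eq_bigr => i _.
by rewrite dotZr dotC.
Qed.

Lemma dot_gt0 v : v != 0 -> 0 < dot v v.
Proof.
move=> v0; rewrite lt0r sumr_ge0 ?andbT => [|i _]; last exact: sqr_ge0.
apply: contraNneq v0 => /psumr_eq0P h; apply/eqP/rowP => i; rewrite mxE.
by apply/eqP; rewrite -sqrf_eq0 expr2 h // => j _; apply: sqr_ge0.
Qed.

Definition attains Q := forall v,
  exists2 y, Q y & forall y', Q y' -> dot v y <= dot v y'.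

Lemma support_min Q v y : Q y -> (forall y', Q y' -> dot v y <= dot v y') ->
  support_fun Q v = - dot v y.
Proof.
move=> Qy miny; congr (- _); apply/eqP; rewrite eq_le; apply/andP; split.
  by apply: ge_inf; [exists (dot v y) => _ [y' /miny ? <-]|exists y].
by apply: lb_le_inf; [exists (dot v y), y|move=> _ [y' /miny ? <-]].
Qed.

Lemma support_ge Q v y : attains Q -> Q y -> - dot v y <= support_fun Q v.
Proof. by move=> /(_ v)[y' Qy' h] Qy; rewrite (support_min Qy' h) lerN2 h. Qed.

Lemma supportZ Q v c : attains Q -> 0 <= c -> support_fun Q (c *: v) = c * support_fun Q v.
Proof.
move=> /(_ v)[y Qy h] c0; rewrite (support_min Qy h) (support_min Qy) => [|y' Qy'].
  by rewrite dotZl mulrN.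
by rewrite !dotZl ler_wpM2l // h.
Qed.

Lemma supportD Q u v : attains Q ->
  support_fun Q (u + v) <= support_fun Q u + support_fun Q v.
Proof.
move=> aQ; have [y Qy h] := aQ (u + v); rewrite (support_min Qy h) dotDl opprD.
by apply: lerD; apply: support_ge.
Qed.

Lemma normal_fan_cover H Q v : attains Q -> H v ->
  exists2 C, normal_fan H Q C & C v.
Proof.
move=> aQ Hv; have [y Qy h] := aQ v.
pose F := [set y | Q y /\ forall y', Q y' -> dot v y <= dot v y'].
exists (normal_cone H Q F); first by exists F => //; split; [exists y|exists v].
by split=> // y' [Qy' h']; rewrite (support_min Qy' h').
Qed.

Lemma normal_fan_linear H Q C : normal_fan H Q C -> exists2 y, Q y &
  forall v, C v -> H v /\ support_fun Q v = - dot v y.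
Proof.
move=> [F [[y Fy] [u FE]] <-]; exists y => [|v [Hv h]]; last by split=> //; apply: h.
by move: Fy; rewrite FE => -[].
Qed.

Lemma polytope_attains P : polytope P -> P !=set0 -> attains P.
Proof.
move=> [s ->] [x0 [m [y [c [sy c0 c1 _]]]]] v.
have [i _] : exists i : 'I_m, true.
  case: m y c sy c0 c1 => [|m] y c _ _; last by exists ord0.
  by rewrite big_ord0 => /eqP; rewrite eq_sym oner_eq0.
have conv w : w \in s -> conv_hull [set` s] w.
  move=> ws; exists 1%N, (fun=> w), (fun=> 1); split=> //; rewrite big_ord1 ?scale1r //.
pose j := [arg min_(j < (SeqSub (sy i))) dot v (val j)]%O.
exists (val j); first exact/conv/valP.
move=> _ [k [x [b [sx b0 b1 ->]]]].
have jmin w : w \in s -> dot v (val j) <= dot v w.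
  move=> ws; rewrite /j; case: arg_minP => //= j' _ h.
  exact: (h (SeqSub ws)).
rewrite dot_sumr -[leLHS]mul1r -b1 mulr_suml; apply: ler_sum => l _.
by rewrite dotZr ler_wpM2l // jmin //; apply: sx.
Qed.

Lemma full_dim_neq0 P : (0 < d)%N -> full_dim P -> P !=set0.
Proof.
move=> d0 fP; have [m [y [c [Py c1 _]]]] : aff_hull P 0 by rewrite fP.
case: m y c Py c1 => [|m] y c Py; last by exists (y ord0).
by rewrite big_ord0 => /eqP; rewrite eq_sym oner_eq0.
Qed.

Lemma full_dim_nonconst P v y : full_dim P -> v != 0 ->
  exists2 y', P y' & dot v y' != dot v y.
Proof.
move=> fP v0; apply: contrapT => h.
have E x : dot v x = dot v y.
  have [m [w [c [Pw c1 ->]]]] : aff_hull P x by rewrite fP.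
  rewrite dot_sumr -[RHS]mul1r -c1 mulr_suml; apply: eq_bigr => i _.
  rewrite dotZr; congr (_ * _); apply: contrapT => /eqP ne.
  by apply: h; exists (w i).
by have := dot_gt0 v0; rewrite E -(E 0) dot0r ltxx.
Qed.

Lemma full_dim_support P v : attains P -> full_dim P -> v != 0 ->
  0 < support_fun P v + support_fun P (- v).
Proof.
move=> aP fP v0; have [y Py h] := aP v; rewrite (support_min Py h).
have [y' Py' ne] := full_dim_nonconst y fP v0.
have := support_ge (- v) aP Py'; rewrite dotNl opprK => le1.
rewrite addrC subr_gt0; apply: lt_le_trans le1.
by rewrite lt_def ne h.
Qed.

(** The barycentre of the generating points is suitable: <v, .> is not constant on P, so some
    generating point exceeds its minimum, and hence so does the average. *)
Lemma polytope_interior P : polytope P -> full_dim P -> P !=set0 ->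
  exists z, forall v, v != 0 -> 0 < support_fun P v + dot v z.
Proof.
move=> pP fP P0; have aP := polytope_attains pP P0.
have [s PE] := pP.
have sP w : w \in s -> P w.
  move=> ws; rewrite PE; exists 1%N, (fun=> w), (fun=> 1); split=> //; rewrite big_ord1 ?scale1r //.
exists ((size s)%:R^-1 *: \sum_(w <- s) w) => v v0.
have [y Py h] := aP v; rewrite (support_min Py h).
have [w ws wy] : exists2 w, w \in s & dot v w != dot v y.
  apply: contrapT => H; have [y' + /eqP[]] := full_dim_nonconst y fP v0.
  rewrite PE => -[m [x [c [sx c0 c1 ->]]]].
  rewrite dot_sumr -[RHS]mul1r -c1 mulr_suml; apply: eq_bigr => i _.
  rewrite dotZr; congr (_ * _); apply: contrapT => /eqP ne.
  by apply: H; exists (x i) => //; apply: sx.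
have s0 : 0 < (size s)%:R :> R by rewrite ltr0n; case: (s) ws.
rewrite dotZr addrC subr_gt0 ltr_pdivlMl // dot_sumr mulr_natl.
have nn w' : w' \in s -> 0 <= dot v w' - dot v y by move=> /sP/h; rewrite subr_ge0.
have : 0 < \sum_(w' <- s) (dot v w' - dot v y).
  rewrite lt0r big_seq sumr_ge0 // andbT psumr_eq0 //.
  by apply/allPn; exists w; rewrite // ws /= subr_eq0.
by rewrite sumrB subr_gt0 big_const_seq count_predT iter_addr addr0.
Qed.

Lemma attains_minkowski P p : attains P -> attains (minkowski_sum P (sym_segment p)) /\
  forall v, support_fun (minkowski_sum P (sym_segment p)) v = support_fun P v + `|dot v p|.
Proof.
move=> aP.
have H v : exists2 y, minkowski_sum P (sym_segment p) y &
    (forall y', minkowski_sum P (sym_segment p) y' -> dot v y <= dot v y') /\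
    - dot v y = support_fun P v + `|dot v p|.
  have [y Py h] := aP v; exists (y + (- Num.sg (dot v p)) *: p).
    exists y => //; exists ((- Num.sg (dot v p)) *: p) => //.
    exists (- Num.sg (dot v p)) => //=; rewrite in_itv /=.
    by rewrite -ler_norml normrN normr_sg lern1 leq_b1.
  split=> [_ [y' Py' [_ [c /= cI <-] <-]]|]; last first.
    by rewrite (support_min Py h) dotDr dotZr opprD mulNr opprK -normrEsg.
  rewrite !dotDr !dotZr lerD ?h // mulNr -normrEsg.
  have : `|c * dot v p| <= `|dot v p|.
    by rewrite normrM ler_piMl // ler_norml; move: cI; rewrite in_itv.
  by rewrite ler_norml => /andP[].
split=> v; have [y Qy [h hE]] := H v; first by exists y.
by rewrite (support_min Qy h).
Qed.

Lemma orth_projE p y : dot (orth_proj p y) p = 0 \/ p = 0.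
Proof.
have [->|p0] := eqVneq p 0; [by right|left].
rewrite /orth_proj dotDl dotNl dotZl mulfVK ?subrr //.
by rewrite gt_eqF // dot_gt0.
Qed.

Lemma attains_quotient P p : attains P -> attains [set orth_proj p y | y in P] /\
  forall v, dot v p = 0 -> support_fun [set orth_proj p y | y in P] v = support_fun P v.
Proof.
move=> aP.
have E v y : dot v (orth_proj p y) = dot (orth_proj p v) y.
  by rewrite /orth_proj dotDr dotDl dotNl dotNr dotZl dotZr (dotC y p); ring.
have H v : exists2 y, P y & forall y', P y' -> dot v (orth_proj p y) <= dot v (orth_proj p y').
  by have [y Py h] := aP (orth_proj p v); exists y => // y' /h; rewrite !E.
split=> v; first by have [y Py h] := H v; exists (orth_proj p y); [exists y|move=> _ [y' /h ? <-]].
move=> vp; have [y Py h] := H v.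
have vE x : dot v (orth_proj p x) = dot v x.
  by rewrite /orth_proj dotDr dotNr dotZr vp mulr0 subr0.
rewrite (@support_min _ v (orth_proj p y)); first last.
- by move=> _ [y' /h ? <-].
- by exists y.
rewrite vE; apply/esym/support_min => // y' Py'.
by rewrite -(vE y) -(vE y') h.
Qed.

Lemma orth_proj_id p v : dot v p = 0 -> orth_proj p v = v.
Proof. by rewrite /orth_proj => ->; rewrite mul0r scale0r subr0. Qed.

Lemma span_cone_row k (M : 'M[R]_(k, d)) i : span_cone M (row i M).
Proof.
exists (delta_mx 0 i); split=> [j|j|]; [|by rewrite inE|by rewrite rowE].
by rewrite mxE ler0n.
Qed.

(** Two cones containing x meet in a common face. As x has no zero coordinate in either of them,
    this face is the whole of both, and the cones coincide. *)
Lemma triangulation_unique H Q k (T : seq 'M[R]_(k, d)) x :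
  attains Q -> triangulation H Q T -> H x ->
  (forall M (c : 'rV[R]_k), M \in T -> x = c *m M -> forall i, c 0 i != 0) ->
  exists2 M, M \in T & span_cone M x /\ forall N, N \in T -> span_cone N x -> N = M.
Proof.
move=> aQ [uT HT cov inj inter] Hx gen.
have : (\bigcup_(M in [set` T]) span_cone M) x.
  by rewrite cov; have [C ? ?] := normal_fan_cover aQ Hx; exists C.
move=> [M /= MT Mx]; exists M => //; split=> // N NT Nx.
have [I [J [EI EJ]]] := inter _ _ MT NT; apply: inj => //.
have full (K : 'M[R]_(k, d)) (L : {set 'I_k}) : K \in T ->
    (span_cone M `&` span_cone N) x ->
    span_cone M `&` span_cone N = span_subcone K L -> L = [set: 'I_k]%SET.
  move=> KT + E; rewrite E => -[c [_ cL xE]]; apply/setP => i; rewrite !inE.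
  by apply: contraTT isT => /cL /eqP; rewrite (negbTE (gen _ _ KT xE i)).
have EM : span_cone M = span_cone M `&` span_cone N.
  by rewrite {1}/span_cone -(full _ _ MT _ EI).
have EN : span_cone N = span_cone M `&` span_cone N.
  by rewrite {1}/span_cone -(full _ _ NT _ EJ).
exact: etrans EN (esym EM).
Qed.
End Support.

Lemma span_coneP (R : realType) d (M : 'M[R]_d) x : M \in unitmx ->
  span_cone M x <-> in_cone M x.
Proof.
move=> uM; split=> [[c [c0 _ ->]]|/forallP h].
  apply/forallP => i; rewrite /cone_coord. by rewrite mulmxK.
by exists (cone_coord M x); split=> // [i|]; rewrite ?inE // /cone_coord mulmxKV.
Qed.

Lemma sum_unique (F : nzRingType) (I : eqType) (s : seq I) (b : pred I) M :
  uniq s -> M \in s -> b M -> (forall N, N \in s -> b N -> N = M) ->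
  \sum_(N <- s) (b N)%:R = 1 :> F.
Proof.
move=> us Ms bM h; rewrite (bigD1_seq M) //= bM big_seq_cond big1 ?addr0 // => N /andP[Ns NM].
by case bN: (b N) => //; rewrite (h N Ns bN) eqxx in NM.
Qed.

(** * Linearity on cones and independence of the triangulation *)

Section Fans.
Variables (R : realType) (n : nat).
Local Notation d := n.+1.
Implicit Types (P Q : set 'rV[R]_d) (p v x y z : 'rV[R]_d).

Lemma dotE (u v : 'rV[R]_d) : dot u v = (u *m v^T) 0 0.
Proof. by rewrite mxE; apply: eq_bigr => i _; rewrite mxE. Qed.

Lemma dot_row (M : 'M[R]_d) (c : 'cV[R]_d) i : (M *m c) i 0 = dot (row i M) c^T.
Proof. by rewrite dotE trmxK -row_mul [RHS]mxE. Qed.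

Lemma dot_coord (M : 'M[R]_d) x u : M \in unitmx ->
  dot x u = \sum_i cone_coord M x 0 i * dot (row i M) u.
Proof. by move=> uM; rewrite -dot_mulmx /cone_coord mulmxKV. Qed.

Definition linear_on P k (M : 'M[R]_(k, d)) : Prop :=
  exists y, forall v, span_cone M v -> support_fun P v = - dot v y.

Lemma linear_onE P k (M : 'M[R]_(k, d)) (c : 'rV_k) : linear_on P M ->
  (forall i, 0 <= c 0 i) ->
  support_fun P (c *m M) = \sum_i c 0 i * support_fun P (row i M).
Proof.
move=> [y h] c0; rewrite h; last by exists c; split=> // i; rewrite inE.
rewrite dot_mulmx -sumrN; apply: eq_bigr => i _.
by rewrite h ?mulrN //; exact: span_cone_row.
Qed.

Lemma triangulation_linear H Q k (T : seq 'M[R]_(k, d)) M :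
  triangulation H Q T -> M \in T -> linear_on Q M.
Proof.
move=> [_ HT _ _ _] /HT[_ _ [C /normal_fan_linear[y Qy h] MC]].
by exists y => v /MC/h[].
Qed.

Lemma triangulation_unit H Q (T : seq 'M[R]_d) M :
  triangulation H Q T -> M \in T -> M \in unitmx.
Proof. by move=> [_ HT _ _ _] /HT[]; rewrite row_free_unit. Qed.

Lemma triangulation_count Q (T : seq 'M[R]_d) x :
  attains Q -> triangulation setT Q T ->
  (forall M i, M \in T -> cone_coord M x 0 i != 0) ->
  \sum_(M <- T) (in_cone M x)%:R = 1 :> R.
Proof.
move=> aQ tT gen.
have [M c MT xE i|M MT [Mx h]] := triangulation_unique aQ tT (x := x) I.
  have := gen _ i MT; rewrite xE /cone_coord mulmxK //.
  exact: triangulation_unit tT MT.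
apply: (@sum_unique _ _ _ _ M) => //; first by case: tT.
  by apply/span_coneP => //; apply: triangulation_unit tT MT.
by move=> N NT /span_coneP => /(_ (triangulation_unit tT NT)); apply: h.
Qed.

Lemma unit_row_neq0 (M : 'M[R]_d) i : M \in unitmx -> row i M != 0.
Proof.
move=> uM; apply: contraTneq isT => h.
have := congr1 (mulmx^~ (invmx M)) h; rewrite mul0mx -row_mul mulmxV //.
by move/rowP/(_ i); rewrite !mxE eqxx => /eqP; rewrite oner_eq0.
Qed.

Lemma sym_segment_bound P p y : minkowski_sum P (sym_segment p) y ->
  exists y' c, [/\ P y', `|c| <= 1 & y = y' + c *: p].
Proof.
move=> [y' Py' [_ [c /= cI <-] <-]]; exists y', c; split=> //.
by rewrite ler_norml; move: cI; rewrite in_itv.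
Qed.

(** The cone is normal to some y + c p with y in P and |c| <= 1. On it the inequalities h_P(v) >=
    -<v, y> and |<v, p>| >= -c <v, p> add up to an equality, so both are equalities; in the second
    one, the sign of c decides the side of H. *)
Lemma refined_fan_linear P p C : attains P ->
  normal_fan setT (minkowski_sum P (sym_segment p)) C ->
  (exists y, forall v, C v -> support_fun P v = - dot v y) /\
  ((forall v, C v -> 0 <= dot v p) \/ (forall v, C v -> dot v p <= 0)).
Proof.
move=> aP /normal_fan_linear[_ /sym_segment_bound[y [c [Py c1 ->]]] h].
have [_ hE] := attains_minkowski p aP.
have key v : C v -> support_fun P v = - dot v y /\ `|dot v p| <= - (c * dot v p).
  move=> /h[_]; rewrite hE dotDr dotZr => E.
  have := support_ge v aP Py; have : `|c * dot v p| <= `|dot v p|.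
    by rewrite normrM ler_piMl.
  rewrite ler_norml => /andP[h1 h2] h3; split; last by lra.
  by lra.
split; first by exists y => v /key[].
case: (lerP c 0) => c0; [left|right] => v /key[_].
  by rewrite leNgt => h1; rewrite leNgt; apply: contra h1 => vp; rewrite ltr0_norm // ; nra.
by rewrite leNgt => h1; rewrite leNgt; apply: contra h1 => vp; rewrite gtr0_norm // ; nra.
Qed.

Lemma dual_factor_eval P v (z : 'rV[R]_d) :
  meval (z 0) (dual_factor P v) = support_fun P v + dot v z.
Proof.
rewrite /dual_factor mevalD mevalC raddf_sum /=; congr (_ + _).
by apply: eq_bigr => i _; rewrite mevalZ mevalXU.
Qed.

Definition cone_term P k (a : R) (M : 'M[R]_(k, d)) : 'RF[R]_d :=
  tofrac (mpolyC d a) / \prod_(j < k) tofrac (dual_factor P (row j M)).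

Lemma cone_term_val P k a (M : 'M[R]_(k, d)) (z : 'rV[R]_d) :
  (forall j, support_fun P (row j M) + dot (row j M) z != 0) ->
  frac_val (meval (z 0)) (cone_term P a M)
    (a / \prod_j (support_fun P (row j M) + dot (row j M) z)).
Proof.
move=> h; rewrite -[X in X / _](mevalC (z 0) a).
under eq_bigr do rewrite -dual_factor_eval.
by apply: frac_val_term => j; rewrite /= dual_factor_eval.
Qed.

(** Q and Q' are kept apart from P because the fan of P is to be compared with its refinement. Where
    all factors are positive, both sums are volumes of cones truncated by h_P + <., w>, and a
    generic point lies in exactly one cone of each triangulation. *)
Lemma dual_vol_indep P Q Q' (T T' : seq 'M[R]_d) z :
  (forall v, v != 0 -> 0 < support_fun P v + dot v z) ->
  attains Q -> attains Q' -> triangulation setT Q T -> triangulation setT Q' T' ->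
  (forall M, M \in T ++ T' -> linear_on P M) ->
  dual_vol P T = dual_vol P T'.
Proof.
move=> zP aQ aQ' tT tT' lin.
have uM M : M \in T ++ T' -> M \in unitmx.
  by rewrite mem_cat => /orP[/(triangulation_unit tT)|/(triangulation_unit tT')].
pose L := [seq (support_fun P (row i M), row i M) | M <- T ++ T', i <- enum 'I_d].
apply/eqP; rewrite -subr_eq0; apply/eqP.
apply: (@frac_eq0_region _ _ _ L z).
  move=> _ /allpairsP[[M i] /= [MT _ ->]] /=; apply/zP/unit_row_neq0; exact: uM.
move=> w Lw.
have pos M i : M \in T ++ T' -> 0 < support_fun P (row i M) + dot (row i M) w.
  move=> MT; apply: (Lw (_, _)); apply/allpairsP; exists (M, i).
  by rewrite mem_enum.
pose val (M : 'M[R]_d) := `|\det M| / \prod_j (support_fun P (row j M) + dot (row j M) w).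
have sumE S : {subset S <= T ++ T'} -> frac_val (meval (w 0)) (dual_vol P S) (\sum_(M <- S) val M).
  move=> sS; apply: frac_val_sum => M /sS MT _; apply: cone_term_val => j.
  by rewrite gt_eqF // pos.
have sT : {subset T <= T ++ T'} by move=> M; rewrite mem_cat => ->.
have sT' : {subset T' <= T ++ T'} by move=> M; rewrite mem_cat orbC => ->.
suff E : \sum_(M <- T) val M = \sum_(M <- T') val M.
  by rewrite -(subrr (\sum_(M <- T') val M)) -{1}E; apply: frac_valD (sumE _ sT) (frac_valN (sumE _ sT')).
apply: (@cone_volume_eq _ _ _ _ (fun v => support_fun P v + dot v w)
  [seq col i (invmx M) | M <- T ++ T', i <- enum 'I_d]) => [M MT|c|x Hx].
- split=> [|i|x /forallP Mx]; [exact: uM|exact: pos|].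
  have {1 2}-> : x = cone_coord M x *m M by rewrite /cone_coord mulmxKV // uM.
  rewrite (linear_onE (lin _ MT) Mx) dot_mulmx -big_split.
  by apply: eq_bigr => i _; rewrite mulrDr.
- by move=> /allpairsP[[M i] /= [MT _ ->]]; apply: col_invmx_neq0; apply: uM.
have gen M i : M \in T ++ T' -> cone_coord M x 0 i != 0.
  move=> MT; rewrite cone_coordE; have /avoidsP := Hx; apply.
  by apply/allpairsP; exists (M, i); rewrite mem_enum.
by rewrite (triangulation_count aQ tT) ?(triangulation_count aQ' tT') // => M i MT; apply: gen; [apply: sT'|apply: sT].
Qed.
End Fans.

(** * Facets lying in H *)

Section FacetCones.
Variables (R : realType) (n : nat).
Local Notation d := n.+1.
Variable (p : 'rV[R]_d).
Hypothesis p0 : p != 0.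
Implicit Types (P Q : set 'rV[R]_d) (v x y z : 'rV[R]_d) (A : 'M[R]_(n, d)).

Definition lift_cone A : 'M[R]_d := col_mx p A.

Definition orth_rows A : Prop := forall i, dot (row i A) p = 0.

Let pp0 : dot p p != 0.
Proof. by rewrite gt_eqF // dot_gt0. Qed.

Lemma row_lift_cone0 A : row ord0 (lift_cone A) = p.
Proof.
by apply/rowP => j; rewrite !mxE; case: splitP => // k _; rewrite ord1.
Qed.

Lemma row_lift_coneS A i : row (lift ord0 i) (lift_cone A) = row i A.
Proof.
apply/rowP => j; rewrite !mxE; case: splitP => k; first by rewrite ord1.
by move=> [/ord_inj->].
Qed.

Lemma mul_lift_cone (c : 'rV[R]_d) A :
  c *m lift_cone A = c 0 ord0 *: p + (\row_i c 0 (lift ord0 i)) *m A.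
Proof.
rewrite mulmx_sum_row big_ord_recl row_lift_cone0; congr (_ + _).
rewrite mulmx_sum_row; apply: eq_bigr => i _.
by rewrite row_lift_coneS !mxE.
Qed.

Lemma orth_dot k (b : 'rV[R]_k) (A : 'M[R]_(k, d)) :
  (forall i, dot (row i A) p = 0) -> dot (b *m A) p = 0.
Proof. by move=> hA; rewrite dot_mulmx big1 // => i _; rewrite hA mulr0. Qed.

Lemma lift_dot (a : R) x : dot x p = 0 -> dot (a *: p + x) p / dot p p = a.
Proof. by move=> xp; rewrite dotDl dotZl xp addr0 mulfK. Qed.

Lemma lift_proj (a : R) x : dot x p = 0 -> orth_proj p (a *: p + x) = x.
Proof. by move=> xp; rewrite /orth_proj lift_dot // addrC addKr. Qed.

Lemma orth_proj_dot x : dot (orth_proj p x) p = 0.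
Proof. by case: (orth_projE p x) => // pE; have := p0; rewrite pE eqxx. Qed.

Lemma orth_projK x : (dot x p / dot p p) *: p + orth_proj p x = x.
Proof. by rewrite /orth_proj addrC subrK. Qed.

Lemma lift_cone_unit A : orth_rows A -> row_free A -> lift_cone A \in unitmx.
Proof.
move=> oA fA; rewrite -row_free_unit; apply: inj_row_free => c.
rewrite mul_lift_cone; set b := \row_i _ => h.
have c0 : c 0 ord0 = 0.
  by rewrite -(lift_dot (c 0 ord0) (orth_dot b oA)) h dotC dot0r mul0r.
have /eqP : b *m A = 0 by move: h; rewrite c0 scale0r add0r.
rewrite mulmx_free_eq0 // => /eqP/rowP b0; apply/rowP => i.
case: (unliftP ord0 i) => [j ->|->]; last by rewrite c0 mxE.
by have := b0 j; rewrite !mxE.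
Qed.

Definition cons_row (a : R) (b : 'rV[R]_n) : 'rV[R]_d :=
  \row_i oapp (b 0) a (unlift ord0 i).

Lemma cons_row0 a b : cons_row a b 0 ord0 = a.
Proof. by rewrite mxE unlift_none. Qed.

Lemma cons_rowS a b i : cons_row a b 0 (lift ord0 i) = b 0 i.
Proof. by rewrite mxE liftK. Qed.

Section Unit.
Variable A : 'M[R]_(n, d).
Hypotheses (oA : orth_rows A) (uA : lift_cone A \in unitmx).

Lemma lift_coord (a : R) (b : 'rV_n) :
  cone_coord (lift_cone A) (a *: p + b *m A) = cons_row a b.
Proof.
have -> : a *: p + b *m A = cons_row a b *m lift_cone A.
  rewrite mul_lift_cone cons_row0; congr (_ + _ *m _).
  by apply/rowP => i; rewrite mxE cons_rowS.
by rewrite /cone_coord mulmxK.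
Qed.

Lemma lift_coordE x : exists b : 'rV_n, orth_proj p x = b *m A /\
  x = (dot x p / dot p p) *: p + b *m A.
Proof.
set c := cone_coord (lift_cone A) x.
have xE : x = c *m lift_cone A by rewrite /c /cone_coord mulmxKV.
rewrite mul_lift_cone in xE; exists (\row_i c 0 (lift ord0 i)).
by rewrite xE lift_proj ?lift_dot //; apply: orth_dot.
Qed.

Lemma in_lift_cone x :
  in_cone (lift_cone A) x <-> 0 <= dot x p /\ span_cone A (orth_proj p x).
Proof.
have ppgt := dot_gt0 p0.
split=> [/forallP h|[xp [b [b0 _ xE]]]].
  have [b [bE xE]] := lift_coordE x.
  have cE : cone_coord (lift_cone A) x = cons_row (dot x p / dot p p) b.
    by rewrite {1}xE lift_coord.
  split.
    have := h ord0; rewrite cE cons_row0.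
    by rewrite pmulr_lge0 // invr_gt0.
  exists b; split=> // i; last by rewrite inE.
  by have := h (lift ord0 i); rewrite cE cons_rowS.
apply/forallP => i; rewrite -(orth_projK x) xE lift_coord.
case: (unliftP ord0 i) => [j ->|->]; first by rewrite cons_rowS.
by rewrite cons_row0 divr_ge0 // ltW.
Qed.

Lemma lift_coord_neq0 x (b : 'rV_n) : (forall i, cone_coord (lift_cone A) x 0 i != 0) ->
  orth_proj p x = b *m A -> forall i, b 0 i != 0.
Proof.
move=> gen xE i; have := gen (lift ord0 i).
by rewrite -(orth_projK x) xE lift_coord cons_rowS.
Qed.

(** Extends h_P + <., w> from H to a function that is linear on the completed cones and equals 1 at
    p, so that the generator p contributes only a factor 1. *)
Definition lift_support P w x : R :=
  support_fun P (orth_proj p x) + dot (orth_proj p x) w + dot x p / dot p p.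

Lemma lift_support_row P w i :
  lift_support P w (row (lift ord0 i) (lift_cone A)) =
  support_fun P (row i A) + dot (row i A) w.
Proof. by rewrite row_lift_coneS /lift_support orth_proj_id // oA mul0r addr0. Qed.

Lemma lift_support_p P w : attains P ->
  lift_support P w (row ord0 (lift_cone A)) = 1.
Proof.
move=> aP; rewrite row_lift_cone0 /lift_support /orth_proj divff // scale1r subrr.
by rewrite -(scale0r 0) supportZ // mul0r dotZl mul0r !add0r.
Qed.

Lemma lift_support_linear P w x : attains P -> linear_on P A ->
  in_cone (lift_cone A) x ->
  lift_support P w x = \sum_i cone_coord (lift_cone A) x 0 i *
                              lift_support P w (row i (lift_cone A)).
Proof.
move=> aP lA /in_lift_cone[xp [b [b0 _ xE]]].
have cE : cone_coord (lift_cone A) x = cons_row (dot x p / dot p p) b.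
  by rewrite -{1}(orth_projK x) xE lift_coord.
rewrite cE big_ord_recl lift_support_p // mulr1 cons_row0.
rewrite /lift_support addrC xE linear_onE // dot_mulmx -big_split; congr (_ + _).
apply: eq_bigr => i _; rewrite -/(lift_support P w _) lift_support_row.
by rewrite cons_rowS mulrDr.
Qed.
End Unit.

Lemma prod_lift_support A P w : attains P -> orth_rows A ->
  \prod_i lift_support P w (row i (lift_cone A)) =
  \prod_j (support_fun P (row j A) + dot (row j A) w).
Proof.
move=> aP oA; rewrite big_ord_recl lift_support_p // mul1r.
by apply: eq_bigr => i _; rewrite lift_support_row.
Qed.

(* The cone of M lies in the half-space of p and has a facet in H, opposite to
   row i. *)
Definition facet_at (M : 'M[R]_d) i : bool :=
  (0 < dot (row i M) p) && [forall k, (k != i) ==> (dot (row k M) p == 0)].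

Lemma row_row' (M : 'M[R]_d) i j : row j (row' i M) = row (lift i j) M.
Proof. by apply/rowP => k; rewrite !mxE. Qed.

Lemma facet_at_orth M i : facet_at M i -> orth_rows (row' i M).
Proof.
move=> /andP[_ /forallP h] k; rewrite row_row'.
by apply/eqP; have /implyP := h (lift i k); apply; rewrite eq_sym neq_lift.
Qed.

(** Replacing row i by p multiplies the determinant, up to sign, by the i-th coordinate of p in the
    basis M. Pairing p with itself, where only row i contributes, gives this coordinate as
    [dot p p / dot (row i M) p]. Hence the factor 1 / ||p||^2 in the limit. *)
Lemma facet_det M i : facet_at M i -> M \in unitmx ->
  `|\det (lift_cone (row' i M))| * dot (row i M) p = dot p p * `|\det M|.
Proof.
move=> /andP[ip /forallP h] uM.
have : dot p p = cone_coord M p 0 i * dot (row i M) p.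
  rewrite (dot_coord p p uM) (bigD1 i) //= big1 ?addr0 // => k ki.
  by have /implyP/(_ ki)/eqP-> := h k; rewrite mulr0.
have dM : `|\det (lift_cone (row' i M))| = `|cone_coord M p 0 i| * `|\det M|.
  rewrite -normrM (expand_det_row (lift_cone (row' i M)) ord0).
  have -> : cone_coord M p 0 i * \det M = \sum_j p 0 j * cofactor M i j.
    rewrite /cone_coord /invmx uM -scalemxAr mxE mulrAC mulVf ?mul1r; last first.
      by rewrite -unitfE -unitmxE.
    by rewrite mxE; apply: eq_bigr => j _; rewrite mxE.
  rewrite -[LHS]mul1r -(normr_sign R i) -normrM mulr_sumr; congr (`|_|).
  apply: eq_bigr => j _; rewrite mulrCA; congr (_ * _).
    by have /rowP/(_ j) := row_lift_cone0 (row' i M); rewrite mxE.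
  rewrite /cofactor mulrA -exprD add0n; congr (_ * \det _).
  apply/matrixP => k l; rewrite !mxE.
  have /rowP/(_ (lift j l)) := row_lift_coneS (row' i M) k.
  by rewrite !mxE.
move=> e; have ci : 0 < cone_coord M p 0 i.
  by rewrite -(pmulr_lgt0 _ ip) -e dot_gt0.
by rewrite dM e (gtr0_norm ci) mulrAC.
Qed.
End FacetCones.

(** * The facets in H as a cover of H *)

Section FacetCount.
Variables (R : realType) (n : nat).
Local Notation d := n.+1.
Variable (p : 'rV[R]_d).
Hypothesis p0 : p != 0.
Implicit Types (P Q : set 'rV[R]_d) (v x y z : 'rV[R]_d) (A : 'M[R]_(n, d)).

Definition one_sided (M : 'M[R]_d) : Prop :=
  (forall k, 0 <= dot (row k M) p) \/ (forall k, dot (row k M) p <= 0).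

(* The transpose of [orth_proj], acting on normal vectors. *)
Definition col_proj (c : 'cV[R]_d) : 'cV[R]_d :=
  c - ((p *m c) 0 0 / dot p p) *: p^T.

Lemma col_projE x c : (orth_proj p x *m c) 0 0 = (x *m col_proj c) 0 0.
Proof.
have E (A B : 'M[R]_1) a : (A - a *: B) 0 0 = A 0 0 - a * B 0 0 by rewrite !mxE.
rewrite /orth_proj /col_proj mulmxBl mulmxBr -scalemxAl -scalemxAr !E -dotE.
by rewrite mulrAC [_ * dot x p]mulrC mulrA.
Qed.

Lemma col_proj_eq0 c : col_proj c = 0 -> exists a, c = a *: p^T.
Proof. by move=> /eqP; rewrite subr_eq0 => /eqP; exists ((p *m c) 0 0 / dot p p). Qed.

Lemma facet_lift_unit M i : facet_at p M i -> M \in unitmx ->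
  lift_cone p (row' i M) \in unitmx.
Proof.
move=> fi uM; have := facet_det p0 fi uM; rewrite !unitmxE !unitfE in uM *.
apply: contra_eqN => /eqP ->; rewrite normr0 mul0r eq_sym mulf_neq0 ?normr_eq0 //.
by rewrite gt_eqF // dot_gt0.
Qed.

Section Term.
Variables (M : 'M[R]_d) (x : 'rV[R]_d) (e : R).
Hypotheses (uM : M \in unitmx) (sM : one_sided M) (xp : 0 <= dot x p) (e0 : 0 < e).
Let x0 := orth_proj p x.
Hypothesis gen : forall i, cone_coord M x0 0 i = 0 ->
  exists a, col i (invmx M) = a *: p^T.
Hypothesis small : forall i, cone_coord M x0 0 i != 0 ->
  e * `|cone_coord M p 0 i| < `|cone_coord M x0 0 i|.

Let cE i : cone_coord M (x0 + e *: p) 0 i = cone_coord M x0 0 i + e * cone_coord M p 0 i.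
Proof. by rewrite cone_coordD cone_coordZ !mxE. Qed.

Let c_ge0 i : cone_coord M x0 0 i != 0 ->
  (0 <= cone_coord M (x0 + e *: p) 0 i) = (0 <= cone_coord M x0 0 i).
Proof. by move=> c0; rewrite cE perturb_ge0 // normrM (gtr0_norm e0) small. Qed.

(* p is proportional to the i-th normal, hence orthogonal to the other rows. *)
Let normal_p i : cone_coord M x0 0 i = 0 ->
  dot (row i M) p != 0 /\ forall k, k != i -> dot (row k M) p = 0.
Proof.
move=> /gen[a cp].
have E k : a * dot (row k M) p = (k == i)%:R.
  have := congr1 (fun c : 'cV[R]_d => c k 0) (mulmx_col_invmx i uM).
  by rewrite cp dot_row linearZ /= trmxK dotZr mxE eqxx andbT.
have a0 : a != 0.
  by apply: contraTneq isT => a0; have := E i; rewrite a0 mul0r eqxx => /esym/eqP; rewrite oner_eq0.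
split=> [|k ki].
  by apply: contraTneq isT => h; have := E i; rewrite h mulr0 eqxx => /esym/eqP; rewrite oner_eq0.
by apply: (mulfI a0); rewrite E (negbTE ki) mulr0.
Qed.

Lemma perturbed_neq0 i : cone_coord M (x0 + e *: p) 0 i != 0.
Proof.
rewrite cE; have [c0|c0] := eqVneq (cone_coord M x0 0 i) 0; last first.
  by rewrite perturb_neq0 // normrM (gtr0_norm e0) small.
rewrite c0 add0r mulf_neq0 ?(gt_eqF e0) //; have [a cp] := gen c0.
have [_ hk] := normal_p c0.
have := dot_coord p p uM; rewrite (bigD1 i) //= big1 ?addr0 => [E|k ki].
  by apply: contraTneq isT => h; have := dot_gt0 p0; rewrite E h mul0r ltxx.
by rewrite hk ?mulr0.
Qed.

(** A cone containing the moved point lies on the side of p. Had it no facet in H, then x0 would be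
    a nonnegative combination of its rows lying in H, hence with coordinate 0 at a row off H, and
    genericity would place the opposite facet in H. If it has such a facet, the coordinate opposite
    to it becomes positive and the others keep their sign. *)
Lemma perturbed_in_cone :
  (in_cone M (x0 + e *: p))%:R =
  \sum_(i | facet_at p M i) (in_cone (lift_cone p (row' i M)) x)%:R :> R.
Proof.
have x0p : dot x0 p = 0 by exact: orth_proj_dot.
have ppgt := dot_gt0 p0.
case: (pickP (facet_at p M)) => [i fi|no]; last first.
  rewrite big_pred0 // (_ : in_cone M _ = false) //; apply/negP => /forallP h.
  have pge : forall k, 0 <= dot (row k M) p.
    case: sM => // sle; have : 0 < dot (x0 + e *: p) p.
      by rewrite dotDl x0p add0r dotZl mulr_gt0.
    rewrite (dot_coord _ _ uM) ltNge sumr_le0 // => k _.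
    by rewrite mulr_ge0_le0 // h.
  have cge k : 0 <= cone_coord M x0 0 k.
    have [->//|c0] := eqVneq (cone_coord M x0 0 k) 0.
    by rewrite -c_ge0 // h.
  have ck0 k : cone_coord M x0 0 k * dot (row k M) p = 0.
    move: x0p; rewrite (dot_coord _ _ uM) => /eqP; rewrite psumr_eq0 => [|j _].
      by move=> /allP/(_ k); rewrite mem_index_enum => /(_ isT)/eqP.
    by rewrite mulr_ge0 // pge.
  have [i ip] : exists i, dot (row i M) p != 0.
    apply: contrapT => H; have := ppgt; rewrite (dot_coord p p uM) big1 ?ltxx // => k _.
    have [->|ne] := eqVneq (dot (row k M) p) 0; first by rewrite mulr0.
    by case: H; exists k.
  have ci0 : cone_coord M x0 0 i = 0.
    by have /eqP := ck0 i; rewrite mulf_eq0 (negbTE ip) orbF => /eqP.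
  have [_ hk] := normal_p ci0.
  have := no i; rewrite /facet_at lt_def ip pge /=.
  by move/negP; apply; apply/forallP => k; apply/implyP => /hk ->.
have := fi; move=> /andP[ip /forallP h].
have hk k : k != i -> dot (row k M) p = 0 by move=> ki; have /implyP/(_ ki)/eqP := h k.
rewrite (big_pred1 i) => [|k]; last first.
  apply/idP/eqP => [/andP[kp _]|->//]; apply/eqP; apply: contraTT kp => ki.
  by rewrite hk ?ltxx.
have ci : cone_coord M x0 0 i = 0.
  move: x0p; rewrite (dot_coord _ _ uM) (bigD1 i) //= big1 ?addr0 => [|k ki].
    by move/eqP; rewrite mulf_eq0 (gt_eqF ip) orbF => /eqP.
  by rewrite hk ?mulr0.
have ei : 0 < cone_coord M p 0 i.
  rewrite -(pmulr_lgt0 _ ip) (_ : _ * _ = dot p p) //.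
  rewrite (dot_coord p p uM) (bigD1 i) //= big1 ?addr0 // => k ki.
  by rewrite hk ?mulr0.
have uA := facet_lift_unit fi uM.
have ck k : k != i -> cone_coord M x0 0 k != 0.
  move=> ki; apply/eqP => /normal_p[_ /(_ i)]; rewrite eq_sym => /(_ ki) ip0.
  by rewrite ip0 ltxx in ip.
congr (nat_of_bool _)%:R; apply/idP/idP => [/forallP H|].
  apply/(in_lift_cone p0 (facet_at_orth fi) uA); split=> //.
  exists (\row_k cone_coord M x0 0 (lift i k)); split=> [k|k|]; last first.
  - have {1}-> : orth_proj p x = cone_coord M x0 *m M by rewrite /cone_coord mulmxKV.
    rewrite mulmx_sum_row (bigD1 i) //= ci scale0r add0r mulmx_sum_row.
    rewrite big_neq_lift; apply: eq_bigr => k _.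
    by rewrite [X in _ = X *: _]mxE row_row'.
  - by rewrite inE.
  by rewrite mxE -c_ge0 ?H // ck // eq_sym neq_lift.
move=> /(in_lift_cone p0 (facet_at_orth fi) uA)[_ [b [b0 _ xE]]].
have x0E : x0 = (\row_k oapp (b 0) 0 (unlift i k)) *m M.
  rewrite /x0 xE !mulmx_sum_row [in RHS](bigD1 i) //= mxE unlift_none scale0r add0r.
  rewrite big_neq_lift; apply: eq_bigr => k _.
  by rewrite [X in _ = X *: _]mxE liftK row_row'.
apply/forallP => k; have [->|ki] := eqVneq k i.
  by rewrite cE ci add0r mulr_ge0 // ltW.
rewrite c_ge0 ?ck // x0E /cone_coord mulmxK // mxE.
by case: unliftP => [k' _|_] /=.
Qed.
End Term.

Variables (P : set 'rV[R]_d) (T' : seq 'M[R]_d) (T0 : seq 'M[R]_(n, d)).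
Hypotheses (aP : attains P)
  (tT' : triangulation setT (minkowski_sum P (sym_segment p)) T')
  (tT0 : triangulation (hyperplane p) (quotient_polytope P p) T0).

Lemma refined_one_sided M : M \in T' -> one_sided M.
Proof.
move=> MT; have [_ HT _ _ _] := tT'; have [_ _ [C fC MC]] := HT _ MT.
have [_ [h|h]] := refined_fan_linear aP fC; [left|right] => k; apply/h/MC/span_cone_row.
Qed.

Lemma refined_linear M : M \in T' -> linear_on P M.
Proof.
move=> MT; have [_ HT _ _ _] := tT'; have [_ _ [C fC MC]] := HT _ MT.
by have [[y h] _] := refined_fan_linear aP fC; exists y => v /MC/h.
Qed.

Lemma quotient_orth A : A \in T0 -> orth_rows p A.
Proof.
move=> AT i; have [_ HT _ _ _] := tT0.
have [_ /(_ i)[_ [F _ E]] _] := HT _ AT.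
have : half_line (row i A) (row i A) by exists 1; rewrite /= ?scale1r.
by rewrite -E => -[].
Qed.

Lemma quotient_unit A : A \in T0 -> lift_cone p A \in unitmx.
Proof.
move=> AT; apply: lift_cone_unit => //; first exact: quotient_orth.
by have [_ HT _ _ _] := tT0; have [] := HT _ AT.
Qed.

Lemma quotient_linear A : A \in T0 -> linear_on P A.
Proof.
move=> AT; have [y h] := triangulation_linear tT0 AT; exists y => v vA.
have [_ hE] := attains_quotient p aP; rewrite -h // hE //.
by case: vA => b [_ _ ->]; apply: orth_dot; apply: quotient_orth.
Qed.

(** Walls of the completed cones, then walls of T' intersected with H and pulled back along the
    projection to H. The wall H itself pulls back to 0 and is removed. *)
Definition facet_normals : seq 'cV[R]_d :=
  [seq col i (invmx (lift_cone p A)) | A <- T0, i <- enum 'I_d] ++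
  [seq c <- [seq col_proj (col i (invmx M)) | M <- T', i <- enum 'I_d] | c != 0].

(** Both sides are 0 if <x, p> < 0. Otherwise both are 1: the projection of x lies in a single cone
    of T0 and, moved slightly along p, in a single cone of T', which [perturbed_in_cone] translates
    into a facet. *)
Lemma facet_count x : avoids facet_normals x ->
  \sum_(A <- T0) (in_cone (lift_cone p A) x)%:R =
  \sum_(M <- T') \sum_(i | facet_at p M i)
     (in_cone (lift_cone p (row' i M)) x)%:R :> R.
Proof.
move=> /avoidsP av.
have facet_unit M i : M \in T' -> facet_at p M i -> lift_cone p (row' i M) \in unitmx.
  by move=> /(triangulation_unit tT') uM fi; apply: facet_lift_unit.
case: (ltrP (dot x p) 0) => xp.
  transitivity (0 : R); [rewrite big_seq big1 //|rewrite big_seq big1 //].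
    move=> A AT; rewrite (_ : in_cone _ _ = false) //; apply/negP.
    move=> /(in_lift_cone p0 (quotient_orth AT) (quotient_unit AT))[].
    by rewrite leNgt xp.
  move=> M MT; rewrite big1 // => i fi.
  rewrite (_ : in_cone _ _ = false) //; apply/negP.
  move=> /(in_lift_cone p0 (facet_at_orth fi) (facet_unit _ _ MT fi))[].
  by rewrite leNgt xp.
transitivity (1 : R).
  have aQ : attains (quotient_polytope P p) by have [] := attains_quotient p aP.
  have [||A AT [Ax h]] := triangulation_unique aQ tT0 (x := orth_proj p x).
  - exact: orth_proj_dot.
  - move=> A c AT; apply: lift_coord_neq0 => //; try exact: quotient_orth.
      exact: quotient_unit.
    move=> i; rewrite cone_coordE; apply: av; rewrite mem_cat; apply/orP; left.
    by apply/allpairsP; exists (A, i); rewrite mem_enum.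
  apply: (@sum_unique _ _ _ _ A) => //; first by case: tT0.
    by apply/(in_lift_cone p0 (quotient_orth AT) (quotient_unit AT)).
  move=> B BT /(in_lift_cone p0 (quotient_orth BT) (quotient_unit BT))[_].
  exact: h.
set x0 := orth_proj p x.
have [e e0 He] := small_perturbation
  [seq (cone_coord M x0 0 i, cone_coord M p 0 i) | M <- T', i <- enum 'I_d].
have small M : M \in T' -> forall i, cone_coord M x0 0 i != 0 ->
    e * `|cone_coord M p 0 i| < `|cone_coord M x0 0 i|.
  move=> MT i; apply: (He (_, _)); apply/allpairsP; exists (M, i).
  by rewrite mem_enum.
have gen M : M \in T' -> forall i, cone_coord M x0 0 i = 0 ->
    exists a, col i (invmx M) = a *: p^T.
  move=> MT i ci; apply: col_proj_eq0; apply/eqP; apply: contraTT isT => ne.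
  have := av (col_proj (col i (invmx M))); rewrite -col_projE -cone_coordE ci eqxx.
  apply; rewrite mem_cat mem_filter ne; apply/orP; right.
  by apply/allpairsP; exists (M, i); rewrite mem_enum.
have aS : attains (minkowski_sum P (sym_segment p)) by have [] := attains_minkowski p aP.
transitivity (\sum_(M <- T') (in_cone M (x0 + e *: p))%:R : R).
  apply/esym/(triangulation_count aS tT') => M i MT.
  apply: perturbed_neq0 => //; first exact: triangulation_unit tT' MT.
    exact: gen.
  exact: small.
rewrite [LHS]big_seq [RHS]big_seq; apply: eq_bigr => M MT.
apply: perturbed_in_cone => //; first exact: triangulation_unit tT' MT.
- exact: refined_one_sided.
- exact: gen.
exact: small.
Qed.

Lemma quotient_row_neq0 A j : A \in T0 -> row j A != 0.
Proof. by move=> AT; have [_ HT _ _ _] := tT0; have [_ /(_ j)[]] := HT _ AT. Qed.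

Lemma facet_sum_near w :
  (forall A j, A \in T0 -> 0 < support_fun P (row j A) + dot (row j A) w) ->
  (forall M i, M \in T' -> 0 < support_fun P (row i M) + dot (row i M) w) ->
  \sum_(A <- T0) `|\det (lift_cone p A)| /
     \prod_j (support_fun P (row j A) + dot (row j A) w) =
  \sum_(M <- T') \sum_(i | facet_at p M i) `|\det (lift_cone p (row' i M))| /
     \prod_j (support_fun P (row j (row' i M)) + dot (row j (row' i M)) w).
Proof.
move=> pos0 pos'.
pose T2 := [seq lift_cone p (row' q.2 q.1) |
  q : 'M[R]_d * 'I_d <- [seq q <- [seq (M, i) | M <- T', i <- index_enum 'I_d] | facet_at p q.1 q.2]].
have := @cone_volume_eq _ _ [seq lift_cone p A | A <- T0] T2 (lift_support p P w) facet_normals.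
rewrite /T2 (big_allpairs2 _ _ (facet_at p) (fun (M : 'M[R]_d) i => lift_cone p (row' i M))) big_map => E.
transitivity (\sum_(A <- T0) `|\det (lift_cone p A)| / \prod_i lift_support p P w (row i (lift_cone p A))).
  rewrite [LHS]big_seq [RHS]big_seq; apply: eq_bigr => A AT.
  by rewrite prod_lift_support //; apply: quotient_orth.
rewrite E {E}; first last.
- move=> x av; rewrite (big_allpairs2 _ _ (facet_at p) (fun (M : 'M[R]_d) i => lift_cone p (row' i M))) big_map.
  exact: facet_count.
- move=> c; rewrite mem_cat mem_filter => /orP[|/andP[]//].
  by move=> /allpairsP[[A i] /= [AT _ ->]]; apply/col_invmx_neq0/quotient_unit.
- move=> N NT; suff [A [-> oA uA lA posA]] : exists A, [/\ N = lift_cone p A, orth_rows p A,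
      lift_cone p A \in unitmx, linear_on P A &
      forall j, 0 < support_fun P (row j A) + dot (row j A) w].
    split=> // [i|x]; last exact: lift_support_linear.
    case: (unliftP ord0 i) => [j ->|->]; first by rewrite lift_support_row.
    by rewrite lift_support_p.
  move: NT; rewrite mem_cat => /orP[/mapP[A AT ->]|/mapP[[M i]]].
    exists A; split=> // [|||j]; first exact: quotient_orth.
    - exact: quotient_unit.
    - exact: quotient_linear.
    exact: pos0.
  rewrite mem_filter /= => /andP[fi /allpairsP[[M' i'] /= [MT _ [eM ei]]]] ->.
  subst M' i'; exists (row' i M); split=> //.
  - exact: facet_at_orth fi.
  - by apply: facet_lift_unit => //; apply: triangulation_unit tT' MT.
  - have [y h] := refined_linear MT; exists y => v [b [b0 _ ->]]; apply: h.
    exists (\row_k oapp (b 0) 0 (unlift i k)); split=> [k|k|].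
    + by rewrite mxE; case: unliftP => [k' _|_] /=.
    + by rewrite inE.
    rewrite !mulmx_sum_row [in RHS](bigD1 i) //= mxE unlift_none scale0r add0r.
    rewrite big_neq_lift; apply: eq_bigr => k _.
    by rewrite mxE liftK row_row'.
  by move=> j; rewrite row_row' pos'.
apply: eq_bigr => M _; apply: eq_bigr => i fi.
by rewrite prod_lift_support //; apply: facet_at_orth fi.
Qed.

(** v is a nonnegative combination of the rows of a cone of T0, on which h_P is linear. For z in the
    face normal to v, the nonnegative numbers h_P(row) + <row, z> have weighted sum 0, so a row with
    nonzero weight lies in the normal cone of that face, which is the ray of v. *)
Lemma ray_in_quotient v :
  ray_gen setT (minkowski_sum P (sym_segment p)) v -> dot v p = 0 ->
  exists A j c, [/\ A \in T0, 0 < c & row j A = c *: v].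
Proof.
move=> [v0 [F [[y Fy] [u FE]] CE]] vp.
have [aS hS] := attains_minkowski p aP.
have [aQ hQ] := attains_quotient p aP.
have [_ _ cov _ _] := tT0.
have : (\bigcup_(M in [set` T0]) span_cone M) v.
  by rewrite cov; have [C ? ?] := normal_fan_cover aQ (vp : hyperplane p v); exists C.
move=> [A /= AT [b [b0 _ vE]]].
have [i bi] : exists i, b 0 i != 0.
  apply: contrapT => H; move/eqP: v0; apply; rewrite vE (_ : b = 0) ?mul0mx //.
  by apply/rowP => i; rewrite mxE; apply/eqP/negPn/negP => bi; apply: H; exists i.
have oA := quotient_orth AT.
have row_ray : normal_cone setT (minkowski_sum P (sym_segment p)) F (row i A).
  split=> // z Fz.
  have Sz : minkowski_sum P (sym_segment p) z by move: Fz; rewrite FE => -[].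
  have hv : support_fun (minkowski_sum P (sym_segment p)) v = - dot v z.
    have : half_line v v by exists 1; rewrite /= ?scale1r.
    by rewrite -CE => -[_ /(_ _ Fz)].
  have key : \sum_k b 0 k * (support_fun P (row k A) + dot (row k A) z) = 0.
    under eq_bigr do rewrite mulrDr.
    rewrite big_split /= -dot_mulmx -linear_onE //; last exact: quotient_linear.
    by rewrite -vE; move: hv; rewrite hS vp normr0 addr0 => ->; rewrite addNr.
  have pos k : 0 <= support_fun P (row k A) + dot (row k A) z.
    have := support_ge (row k A) aS Sz; rewrite hS oA normr0 addr0.
    by rewrite -subr_ge0 opprK.
  move: key => /eqP; rewrite psumr_eq0 => [/allP/(_ i)|k _]; last by rewrite mulr_ge0.
  rewrite mem_index_enum => /(_ isT); rewrite mulf_eq0 (negbTE bi) /= addr_eq0 => /eqP E.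
  by rewrite hS oA normr0 addr0.
move: row_ray; rewrite CE => -[c /= c0 cE].
exists A, i, c; split=> //; rewrite lt_def c0 andbT.
by apply: contraTneq (quotient_row_neq0 i AT) => c1; rewrite -cE c1 scale0r eqxx.
Qed.

(** This makes [proj_regular] control every factor that is constant along p, whichever triangulation
    or list of generators it comes from. *)
Lemma ray_regular v z : ray_gen setT (minkowski_sum P (sym_segment p)) v ->
  dot v p = 0 -> proj_regular P p T0 z -> support_fun P v + dot v z != 0.
Proof.
move=> rv vp reg; have [A [j [c [AT c0 E]]]] := ray_in_quotient rv vp.
have [_ hQ] := attains_quotient p aP.
have := reg _ AT j; rewrite /quotient_polytope hQ ?E ?dotZl ?vp ?mulr0 //.
by rewrite supportZ ?ltW // -mulrDr mulf_eq0 (gt_eqF c0).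
Qed.

Lemma refined_ray M i : M \in T' ->
  ray_gen setT (minkowski_sum P (sym_segment p)) (row i M).
Proof. by move=> MT; have [_ HT _ _ _] := tT'; have [_ /(_ i)] := HT _ MT. Qed.

(** Both sides are values of rational functions that agree where all factors are positive, hence are
    equal; at z0 their denominators are nonzero by regularity and [ray_regular]. *)
Lemma dual_vol_proj_facets z z0 :
  (forall v, v != 0 -> 0 < support_fun P v + dot v z) ->
  proj_regular P p T0 z0 ->
  dual_vol_proj P p T0 z0 =
  \sum_(M <- T') \sum_(i | facet_at p M i) `|\det (lift_cone p (row' i M))| /
     \prod_j (support_fun P (row j (row' i M)) + dot (row j (row' i M)) z0).
Proof.
move=> zP reg; have [_ hQ] := attains_quotient p aP.
pose f0 := \sum_(A <- T0) cone_term P `|\det (lift_cone p A)| A.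
pose f1 := \sum_(M <- T') \sum_(i | facet_at p M i)
   cone_term P `|\det (lift_cone p (row' i M))| (row' i M).
have val w :
    (forall A j, A \in T0 -> support_fun P (row j A) + dot (row j A) w != 0) ->
    (forall M i, M \in T' -> (dot (row i M) p = 0) -> support_fun P (row i M) + dot (row i M) w != 0) ->
    frac_val (meval (w 0)) f0 (\sum_(A <- T0) `|\det (lift_cone p A)| /
     \prod_j (support_fun P (row j A) + dot (row j A) w)) /\
    frac_val (meval (w 0)) f1 (\sum_(M <- T') \sum_(i | facet_at p M i) `|\det (lift_cone p (row' i M))| /
     \prod_j (support_fun P (row j (row' i M)) + dot (row j (row' i M)) w)).
  move=> h0 h1; split; apply: frac_val_sum => M MT _.
    by apply: cone_term_val => j; apply: h0.
  apply: frac_val_sum => i _ fi; apply: cone_term_val => j; rewrite row_row'.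
  by apply: h1 => //; have := facet_at_orth fi j; rewrite row_row'.
have fE : f0 = f1.
  pose L := [seq (support_fun P (row j A), row j A) | A <- T0, j <- enum 'I_n] ++
            [seq (support_fun P (row i M), row i M) | M <- T', i <- enum 'I_d].
  apply/eqP; rewrite -subr_eq0; apply/eqP; apply: (@frac_eq0_region _ _ _ L z).
    move=> a; rewrite mem_cat => /orP[] /allpairsP[[M i] /= [MT _ ->]] /=; apply: zP.
      exact: quotient_row_neq0.
    by have [] := refined_ray i MT.
  move=> w Lw.
  have pos0 A j : A \in T0 -> 0 < support_fun P (row j A) + dot (row j A) w.
    move=> AT; apply: (Lw (_, _)); rewrite mem_cat; apply/orP; left.
    by apply/allpairsP; exists (A, j); rewrite mem_enum.
  have pos' M i : M \in T' -> 0 < support_fun P (row i M) + dot (row i M) w.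
    move=> MT; apply: (Lw (_, _)); rewrite mem_cat; apply/orP; right.
    by apply/allpairsP; exists (M, i); rewrite mem_enum.
  have [||v0 v1] := val w; [by move=> A j /pos0/gt_eqF->|by move=> M i /pos'/gt_eqF->|].
  have := frac_valD v0 (frac_valN v1); rewrite facet_sum_near // subrr.
  exact.
have [||v0 v1] := val z0.
- move=> A j AT; have := reg _ AT j; rewrite /quotient_polytope hQ //.
  exact: quotient_orth.
- by move=> M i MT vp; apply: (ray_regular _ vp) => //; apply: refined_ray.
move: v0; rewrite fE => v0; rewrite -(frac_val_uniq v0 v1) {v0 v1}.
rewrite /dual_vol_proj [LHS]big_seq [RHS]big_seq; apply: eq_bigr => A AT.
congr (_ / _); apply: eq_bigr => j _; rewrite /quotient_polytope hQ //.
exact: quotient_orth.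
Qed.
End FacetCount.

(** * The cones on either side of H *)

Section Halves.
Variables (R : realType) (n : nat).
Local Notation d := n.+1.
Implicit Types (P Q : set 'rV[R]_d) (p v x y z : 'rV[R]_d) (M : 'M[R]_d)
  (T : seq 'M[R]_d) (G : seq 'rV[R]_d).

Lemma sym_segmentN p : sym_segment (- p) = sym_segment p.
Proof.
rewrite eqEsubset; split=> _ [c /= cI <-]; exists (- c); rewrite /= ?in_itv /=.
- by move: cI; rewrite in_itv /= -!ler_norml normrN.
- by rewrite scaleNr scalerN.
- by move: cI; rewrite in_itv /= -!ler_norml normrN.
by rewrite scalerN scaleNr opprK.
Qed.

Lemma hyperplaneN p : hyperplane (- p) = hyperplane p.
Proof.
rewrite eqEsubset; split=> v; rewrite /hyperplane /= dotNr => /eqP.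
  by rewrite oppr_eq0 => /eqP.
by move=> /eqP ->; rewrite oppr0.
Qed.

Lemma orth_projN p : orth_proj (- p) = orth_proj p.
Proof.
by apply/funext => v; rewrite /orth_proj !dotNr dotNl opprK scalerN mulNr scaleNr opprK.
Qed.

Lemma quotient_polytopeN P p : quotient_polytope P (- p) = quotient_polytope P p.
Proof. by rewrite /quotient_polytope orth_projN. Qed.

Lemma half_line_id v : half_line v v.
Proof. by exists 1; rewrite /= ?scale1r. Qed.

Lemma half_line_eq v w : w != 0 -> half_line v = half_line w ->
  exists2 c, 0 < c & w = c *: v.
Proof.
move=> w0 E; have := half_line_id w; rewrite -E => -[c /= c0 cE]; exists c => //.
by rewrite lt_def c0 andbT; apply: contraNneq w0 => c1; rewrite -cE c1 scale0r.
Qed.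

(* If h_P is linear on the segment from v to v + e w, which stays on one side of
   H, then so is the support function of P + [-p, p]. *)
Lemma old_ray_pos P p v : attains P -> full_dim P ->
  ray_gen setT (minkowski_sum P (sym_segment p)) v -> 0 < dot v p ->
  ray_gen setT P v.
Proof.
move=> aP fP [v0 [F [[y0 Fy0] [u FE]] CE]] vp; split=> //.
have [_ hS] := attains_minkowski p aP.
pose F1 := [set y | P y /\ forall y', P y' -> dot v y <= dot v y'].
have hF1 y : F1 y -> support_fun P v = - dot v y.
  by move=> [Py h]; rewrite (support_min Py h).
exists F1; first by have [y Py h] := aP v; split; [exists y|exists v].
rewrite eqEsubset; split=> [w [_ hw]|_ [c /= c0 <-]]; last first.
  by split=> // y /hF1 h; rewrite supportZ // h dotZl mulrN.
have [e e0 He] := small_perturbation [:: (dot v p, dot w p)].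
have : `|e * dot w p| < dot v p.
  rewrite normrM (gtr0_norm e0) -[X in _ < X](gtr0_norm vp).
  by apply: (He (_, _)); rewrite ?mem_head //= gt_eqF.
rewrite ltr_norml => /andP[ewp _].
have vwp : 0 < dot (v + e *: w) p by rewrite dotDl dotZl; lra.
have : half_line v (v + e *: w).
  rewrite -CE; split=> // y' Fy'.
  have : minkowski_sum P (sym_segment p) y' by move: Fy'; rewrite FE => -[].
  move=> /sym_segment_bound[y [c [Py c1 yE]]].
  have hv : support_fun P v + dot v p = - dot v y - c * dot v p.
    have := half_line_id v; rewrite -CE => -[_ /(_ _ Fy')].
    by rewrite hS (gtr0_norm vp) yE dotDr dotZr opprD.
  have h1 := support_ge v aP Py.
  have cN : c = -1.
    have : - 1 <= c by move: c1; rewrite ler_norml => /andP[].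
    rewrite le_eqVlt => /orP[/eqP<-//|c2]; exfalso.
    have : 0 < c * dot v p + dot v p.
      by rewrite -[X in _ + X]mul1r -mulrDl mulr_gt0 // -ltrBlDr sub0r.
    by move: hv h1; move: (support_fun P v) (dot v y) (c * dot v p)%R (dot v p) => a b k f; lra.
  have hvy : support_fun P v = - dot v y by move: hv; rewrite cN; lra.
  have F1y : F1 y.
    by split=> // y2 Py2; have := support_ge v aP Py2; rewrite hvy lerN2.
  have hw' := hw _ F1y.
  have h2 := support_ge (v + e *: w) aP Py.
  have := supportD v (e *: w) aP; rewrite (supportZ w aP (ltW e0)) hw' hvy => h3.
  rewrite hS (gtr0_norm vwp) yE cN scaleN1r dotDr dotNr opprD opprK; congr (_ + _).
  by apply/eqP; rewrite eq_le h2 andbT (le_trans h3) // dotDl dotZl opprD mulrN.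
move=> [c /= c0 cE].
have wE : w = ((c - 1) / e) *: v.
  have : e *: w = (c - 1) *: v by rewrite scalerBl scale1r cE addrC addKr.
  move/(congr1 (fun x => e^-1 *: x)); rewrite !scalerA mulVf ?gt_eqF // scale1r => ->.
  by rewrite mulrC.
move: ((c - 1) / e) wE => a wE; exists a => //=; rewrite leNgt; apply/negP => a0.
have [y Py h] := aP v; have F1y : F1 y by [].
have hv := hF1 _ F1y; have := hw _ F1y.
rewrite wE -[a]opprK scaleNr -scalerN supportZ ?oppr_ge0 ?ltW // dotZl dotNl => hNv.
have := full_dim_support aP fP v0; rewrite hv.
have na0 : - a != 0 by rewrite oppr_eq0 lt_eqF.
by move: hNv; rewrite -mulrN => hNv; rewrite (mulfI na0 hNv) opprK addNr ltxx.
Qed.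

Definition pos_cone p M : bool := [forall k, 0 <= dot (row k M) p].

Definition half_vol P p T : 'RF[R]_d :=
  \sum_(M <- T | pos_cone p M) cone_term P `|\det M| M.

Lemma pos_coneN p M : p != 0 -> M \in unitmx -> one_sided p M ->
  pos_cone (- p) M = ~~ pos_cone p M.
Proof.
move=> p0 uM sM; apply/forallP/forallPn => [h|[k]]; last first.
  rewrite -ltNge => kp i; rewrite dotNr oppr_ge0.
  by case: sM => // h; move: (h k); rewrite leNgt kp.
apply: contrapT => H.
have h0 k : dot (row k M) p = 0.
  apply/eqP; rewrite eq_le -oppr_ge0 -dotNr h /=; apply/negPn/negP => kp.
  by apply: H; exists k.
by have := dot_gt0 p0; rewrite (dot_coord p p uM) big1 ?ltxx // => k _; rewrite h0 mulr0.
Qed.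

Lemma half_vol_sum P p T : p != 0 ->
  (forall M, M \in T -> M \in unitmx /\ one_sided p M) ->
  half_vol P p T + half_vol P (- p) T = dual_vol P T.
Proof.
move=> p0 HT; rewrite /dual_vol (bigID (pos_cone p)) /=; congr (_ + _).
rewrite /half_vol big_seq_cond [RHS]big_seq_cond; apply: eq_bigl => M.
by case MT : (M \in T) => //=; have [uM sM] := HT _ MT; rewrite pos_coneN.
Qed.

Lemma has_denominator_sum (I : eqType) (s : seq I) (C : pred I) (F : I -> 'RF[R]_d) B :
  B != 0 -> (forall i, i \in s -> C i -> has_denominator (F i) B) ->
  has_denominator (\sum_(i <- s | C i) F i) B.
Proof.
move=> B0; elim: s => [|i s IH] H.
  by exists 0; rewrite big_nil rmorph0 mul0r.
rewrite big_cons; have [A AE] : has_denominator (\sum_(j <- s | C j) F j) B.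
  by apply: IH => j js; apply: H; rewrite inE js orbT.
case: ifP => [Ci|_]; last by exists A.
have [A' ->] := H i (mem_head _ _) Ci; exists (A' + A).
by rewrite AE rmorphD mulrDl.
Qed.

Lemma dual_factorZ P c v : attains P -> 0 <= c ->
  dual_factor P (c *: v) = c *: dual_factor P v.
Proof.
move=> aP c0; rewrite /dual_factor supportZ // scalerDr; congr (_ + _).
  by rewrite -mul_mpolyC mpolyCM.
by rewrite scaler_sumr; apply: eq_bigr => i _; rewrite mxE scalerA.
Qed.

(** A single product, from which the factors of a cone can be selected at once; -p in place of p
    gives the denominator for W_-. *)
Definition half_denominator P p G : 'RX[R]_d :=
  \prod_(v <- G | ~~ is_old_ray P v || (0 <= dot v p)) dual_factor P v.

Lemma half_denominatorE P p G :
  half_denominator P p G = B_pos P p G * B_zero P p G * D_new P G.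
Proof.
rewrite /half_denominator (bigID (is_old_ray P)) /=; congr (_ * _); last first.
  by apply: eq_bigl => v; case: is_old_ray; rewrite ?andbF.
rewrite (bigID (fun v => 0 < dot v p)) /=; congr (_ * _); apply: eq_bigl => v.
  by case: is_old_ray; rewrite ?andbF //= ?andbT andbC andb_idr // => /ltW.
by case: is_old_ray; rewrite ?andbF //= andbT -leNgt -eq_le eq_sym.
Qed.

Lemma half_denominatorN P p G :
  half_denominator P (- p) G = B_neg P p G * B_zero P p G * D_new P G.
Proof.
rewrite half_denominatorE; congr (_ * _ * _); apply: eq_bigl => v.
  by rewrite dotNr oppr_gt0.
by rewrite dotNr oppr_eq0.
Qed.

(** The rows of M are positive multiples of generators in G, which are distinct because the rows are
    independent, so each factor is used at most once. All of them satisfy <v, p> >= 0 and therefore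
    occur in the product. *)
Lemma cone_term_denominator P p Q G M : attains P -> M \in unitmx -> pos_cone p M ->
  ray_gens setT Q G -> (forall i, ray_gen setT Q (row i M)) ->
  (forall v, v \in G -> dual_factor P v != 0) ->
  has_denominator (cone_term P `|\det M| M) (half_denominator P p G).
Proof.
move=> aP uM /forallP pM [uG _ genG] rM G0.
have /choice[gc Hgc] : forall i, exists gc : 'rV[R]_d * R,
    [/\ gc.1 \in G, 0 < gc.2 & row i M = gc.2 *: gc.1].
  move=> i; have [v [[vG vE] _]] := genG _ (rM i).
  by have [|c c0 cE] := half_line_eq _ vE; [have [] := rM i|exists (v, c)].
pose g i := (gc i).1.
have ginj : injective g.
  move=> i j gij; apply/eqP; apply: contraT => ij.
  have [[_ ci rowi] [_ cj rowj]] := (Hgc i, Hgc j).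
  have : (gc j).2 *: row i M - (gc i).2 *: row j M = 0.
    by rewrite rowi rowj -/(g i) -/(g j) gij !scalerA mulrC subrr.
  move=> /(congr1 (fun x => (x *m invmx M) 0 i)).
  rewrite mul0mx mulmxBl -!scalemxAl -!row_mul mulmxV // !mxE eqxx eq_sym (negbTE ij).
  by rewrite mulr1 mulr0 subr0 => /eqP; rewrite gt_eqF.
pose gs := [seq g i | i <- enum 'I_d].
have ugs : uniq gs by rewrite map_inj_uniq ?enum_uniq.
have gsC v : v \in gs -> (v \in G) && (~~ is_old_ray P v || (0 <= dot v p)).
  move=> /mapP[i _ ->]; have [-> ci rowi] := Hgc i; apply/orP; right.
  by have := pM i; rewrite rowi dotZl pmulr_rge0.
pose rest := \prod_(v <- G | (~~ is_old_ray P v || (0 <= dot v p)) && (v \notin gs)) dual_factor P v.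
have denE : half_denominator P p G = \prod_i dual_factor P (g i) * rest.
  rewrite /half_denominator (bigID (mem gs)) /=; congr (_ * _).
  rewrite -big_filter -(big_map g xpredT (dual_factor P)) -[index_enum _]enumT.
  apply: perm_big; apply: uniq_perm => //; first exact: filter_uniq.
  move=> v; rewrite mem_filter; apply/andP/idP => [[/andP[_ ?] _]//|vgs].
  by have /andP[-> ->] := gsC _ vgs; rewrite /= vgs.
have prodE : \prod_j dual_factor P (row j M) =
    mpolyC d (\prod_j (gc j).2) * \prod_i dual_factor P (g i).
  rewrite rmorph_prod -big_split; apply: eq_bigr => j _.
  by have [_ cj ->] := Hgc j; rewrite dual_factorZ ?ltW //= mul_mpolyC.
have c0 : 0 < \prod_j (gc j).2 by apply: prodr_gt0 => j _; have [] := Hgc j.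
have g0 : \prod_i dual_factor P (g i) != 0.
  by apply/prodf_neq0 => i _; apply: G0; have [] := Hgc i.
have rest0 : rest != 0.
  rewrite /rest big_seq_cond; elim/big_ind: _ => [|x y|v /andP[/G0]//].
    exact: oner_neq0.
  exact: mulf_neq0.
exists (mpolyC d (`|\det M| / \prod_j (gc j).2) * rest).
rewrite /cone_term -rmorph_prod prodE denE.
apply/eqP; rewrite frac_eqP ?mulf_neq0 // ?mpolyC_eq0 ?gt_eqF //; apply/eqP.
rewrite -[in LHS](divfK (lt0r_neq0 c0) `|\det M|) rmorphM /=.
by ring.
Qed.

(** On the side of p, <v, x p> is x |<p, v>|, so the shift of z reproduces the deformation of P. *)
Lemma shift_dual_factor P p v : 0 <= dot v p ->
  comp_mpoly (mktuple (shift_along p)) (dual_factor P v) = dual_factor_x P p v.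
Proof.
move=> vp; rewrite /dual_factor /dual_factor_x comp_mpolyD comp_mpolyC raddf_sum /=.
rewrite -addrA; congr (_ + _); rewrite dotC ger0_norm // /dot scaler_suml -big_split /=.
apply: eq_bigr => i _; rewrite comp_mpolyZ comp_mpolyXU nth_mktuple /shift_along.
by rewrite scalerDr scalerA addrC.
Qed.

Lemma dual_factor_xN P p v : dual_factor_x P (- p) v = dual_factor_x P p v.
Proof. by rewrite /dual_factor_x dotNl normrN. Qed.

Lemma dual_factor_x_neq0 z P p v : 0 < support_fun P v + dot v z ->
  dual_factor_x P p v != 0.
Proof.
(* The variable x, at index 0, is given the value 0. *)
move=> vz; pose w (i : 'I_d.+1) := oapp (z 0) 0 (unlift ord0 i).
suff E : meval w (dual_factor_x P p v) = support_fun P v + dot v z.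
  by apply: contraTneq vz => x0; rewrite -E x0 meval0 ltxx.
rewrite /dual_factor_x !mevalD mevalC mevalZ raddf_sum /= mevalXU /w unlift_none /= mulr0 addr0.
by congr (_ + _); apply: eq_bigr => i _; rewrite mevalZ mevalXU liftK.
Qed.

Lemma half_vol_subst P p T z : (forall v, v != 0 -> 0 < support_fun P v + dot v z) ->
  (forall M, M \in T -> M \in unitmx) ->
  rat_subst (shift_along p) (half_vol P p T) =
  \sum_(M <- T | pos_cone p M) tofrac (mpolyC d.+1 `|\det M|)
     / \prod_(j < d) tofrac (dual_factor_x P p (row j M)).
Proof.
move=> zP uT; apply: rat_substE; apply: frac_val_sum => M MT /forallP pM.
have E j : comp_mpoly (mktuple (shift_along p)) (dual_factor P (row j M)) =
    dual_factor_x P p (row j M) by apply: shift_dual_factor.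
rewrite -[X in tofrac X / _](comp_mpolyC _ (mktuple (shift_along p))).
under [X in _ / X]eq_bigr do rewrite -E.
apply: frac_val_term => j /=; rewrite tofrac_eq0 E.
by apply: (@dual_factor_x_neq0 z); apply/zP/unit_row_neq0/uT.
Qed.

Lemma dual_vol_x_split P p T z : p != 0 ->
  (forall v, v != 0 -> 0 < support_fun P v + dot v z) ->
  (forall M, M \in T -> M \in unitmx /\ one_sided p M) ->
  dual_vol_x P p T = rat_subst (shift_along p) (half_vol P p T) +
                     rat_subst (shift_along (- p)) (half_vol P (- p) T).
Proof.
move=> p0 zP HT; have uT M : M \in T -> M \in unitmx by move=> /HT[].
rewrite !(half_vol_subst _ zP uT) /dual_vol_x (bigID (pos_cone p)) /=; congr (_ + _).
rewrite big_seq_cond [RHS]big_seq_cond; apply: eq_big => M.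
  by case MT : (M \in T) => //=; have [uM sM] := HT _ MT; rewrite pos_coneN.
by move=> _; congr (_ / _); apply: eq_bigr => j _; rewrite dual_factor_xN.
Qed.
End Halves.

(** * Limits and uniqueness *)

Section LimitsAtInfinity.
Variable R : realType.

Lemma affine_neq0_near (L : seq (R * R)) :
  (forall ab, ab \in L -> ab.2 = 0 -> ab.1 != 0) ->
  \forall t \near +oo, forall ab, ab \in L -> ab.1 + t * ab.2 != 0.
Proof.
move=> HL; have [e e0 He] := small_perturbation [seq (ab.2, ab.1) | ab : R * R <- L].
near=> t => ab abL; have [b0|b0] := eqVneq ab.2 0.
  by rewrite b0 mulr0 addr0 HL.
have t_gt : e^-1 < t by near: t; apply: nbhs_pinfty_gt; rewrite num_real.
have t0 : 0 < t by apply: lt_trans t_gt; rewrite invr_gt0.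
rewrite addrC perturb_neq0 // normrM (gtr0_norm t0).
have := He (ab.2, ab.1) (map_f (fun ab : R * R => (ab.2, ab.1)) abL) b0; rewrite /= mulrC -ltr_pdivlMr // => h.
by apply: lt_trans h _; rewrite mulrC ltr_pM2r ?normr_gt0.
Unshelve. all: by end_near. Qed.

Lemma cvg_invy : (t : R)^-1 @[t --> +oo] --> (0 : R).
Proof. by apply/gtr0_cvgV0 => //; apply: nbhs_pinfty_gt; rewrite num_real. Qed.

Lemma cvg_div_affine (a b : R) : b != 0 -> t / (a + t * b) @[t --> +oo] --> b^-1.
Proof.
move=> b0; have h : (a * t^-1 + b)^-1 @[t --> +oo] --> b^-1.
  apply: cvgV => //; rewrite -[X in _ --> X]add0r -[X in _ --> X + _](mulr0 a).
  by apply: cvgD; [apply: cvgMr; apply: cvg_invy|apply: cvg_cst].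
apply: cvg_trans h; apply: near_eq_cvg; near=> t.
have t0 : t != 0 by rewrite gt_eqF //; near: t; apply: nbhs_pinfty_gt; rewrite num_real.
have -> : a + t * b = t * (a * t^-1 + b) by rewrite mulrDr mulrCA divff // mulr1.
by rewrite invfM mulrA divff // mul1r.
Unshelve. all: by end_near. Qed.

Lemma cvg_inv_affine (a b : R) : b != 0 -> (a + t * b)^-1 @[t --> +oo] --> (0 : R).
Proof.
move=> b0; rewrite -(mul0r b^-1).
have h : t^-1 * (t / (a + t * b)) @[t --> +oo] --> 0 * b^-1.
  by apply: cvgM; [apply: cvg_invy|apply: cvg_div_affine].
apply: cvg_trans h; apply: near_eq_cvg; near=> t => /=.
have t0 : t != 0 by rewrite gt_eqF //; near: t; apply: nbhs_pinfty_gt; rewrite num_real.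
by rewrite mulrA mulVf // mul1r.
Unshelve. all: by end_near. Qed.

(** One growing factor absorbs t; any further growing factor sends the term to 0. *)
Lemma cvg_term_affine (I : finType) (c : R) (a b : I -> R) i : b i != 0 ->
  t * (c / \prod_j (a j + t * b j)) @[t --> +oo] -->
  c / b i * \prod_(j | j != i) (if b j == 0 then (a j)^-1 else 0).
Proof.
move=> bi.
rewrite [X in X @ _](_ : _ = (fun t => c * (t / (a i + t * b i)) *
    \prod_(j | j != i) (a j + t * b j)^-1)).
  apply: cvgM; first by apply: cvgMr; apply: cvg_div_affine.
  apply: cvg_big => [|j _]; first exact: mul_continuous.
  have [->|b0] := eqVneq (b j) 0; last exact: cvg_inv_affine.
  by under eq_fun do rewrite mulr0 addr0; apply: cvg_cst.
apply/funext => t; rewrite (bigD1 i) //= prodfV invfM.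
by rewrite !mulrA; congr (_ / _ / _); rewrite mulrC.
Qed.

(** Write the polynomial as q X + c. Division by t shows that q tends to 0; by induction q is
    constant, hence 0. *)
Lemma poly_cvg_const (q : {poly R}) (l : R) : q.[t] @[t --> +oo] --> l -> (size q <= 1)%N.
Proof.
elim/poly_ind: q l => [|q c IH] l h; first by rewrite size_poly0.
have hq : q.[t] @[t --> +oo] --> (0 : R).
  have h1 : ((q * 'X + c%:P).[t] - c) * t^-1 @[t --> +oo] --> (l - c) * 0.
    by apply: cvgM; [apply: cvgB => //; apply: cvg_cst|apply: cvg_invy].
  rewrite mulr0 in h1; apply: cvg_trans h1; apply: near_eq_cvg; near=> t.
  have t0 : t != 0 by rewrite gt_eqF //; near: t; apply: nbhs_pinfty_gt; rewrite num_real.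
  by rewrite !hornerE addrK mulfK.
have /size1_polyC qE := IH _ hq.
have k0 : q`_0 = 0.
  have E : horner q = fun=> q`_0 by apply/funext => t; rewrite {1}qE hornerC.
  have := cvg_lim (@Rhausdorff R) hq; rewrite E lim_cst //.
  by apply; exact: proper_pinfty_nbhs.
have q0 : q = 0 by rewrite qE k0.
by rewrite q0 mul0r add0r size_polyC_leq1.
Unshelve. all: by end_near. Qed.
End LimitsAtInfinity.

(** * Limits of the half volumes along p *)

Section Limit.
Variables (R : realType) (n : nat).
Local Notation d := n.+1.
Variables (p : 'rV[R]_d) (P : set 'rV[R]_d) (T' : seq 'M[R]_d) (T0 : seq 'M[R]_(n, d))
  (zi : 'rV[R]_d).
Hypotheses (p0 : p != 0) (aP : attains P)
  (tT' : triangulation setT (minkowski_sum P (sym_segment p)) T')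
  (tT0 : triangulation (hyperplane p) (quotient_polytope P p) T0)
  (ziP : forall v, v != 0 -> 0 < support_fun P v + dot v zi).

Lemma facet_at_pos M i : facet_at p M i -> pos_cone p M.
Proof.
move=> /andP[ip /forallP h]; apply/forallP => k.
have [->|ki] := eqVneq k i; first exact: ltW.
by have /implyP/(_ ki)/eqP-> := h k.
Qed.

(** A facet in H is exactly the case of a single growing factor. The scalar s separates the side of
    the cone from the direction of motion: for W_- the cones are taken for -p while z0 still moves
    along p. *)
Lemma cone_term_limit (s : R) M z0 : s != 0 -> M \in T' -> pos_cone p M ->
  t * (`|\det M| / \prod_j (support_fun P (row j M) + dot (row j M) z0
         + t * (s * dot (row j M) p))) @[t --> +oo] -->
  \sum_(i | facet_at p M i) `|\det (lift_cone p (row' i M))| /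
     \prod_j (support_fun P (row j (row' i M)) + dot (row j (row' i M)) z0)
  / (s * dot p p).
Proof.
move=> s0 MT /forallP pM; have uM := triangulation_unit tT' MT.
have pp := dot_gt0 p0.
pose a j := support_fun P (row j M) + dot (row j M) z0.
pose b j := s * dot (row j M) p.
have lim i := @cvg_term_affine R 'I_d `|\det M| a b i.
case: (pickP (facet_at p M)) => [i fi|no].
  have /andP[ip /forallP hi] := fi.
  have bi : b i != 0 by rewrite mulf_neq0 // gt_eqF.
  have hk k : k != i -> dot (row k M) p = 0 by move=> ki; have /implyP/(_ ki)/eqP := hi k.
  rewrite (big_pred1 i) => [|k]; last first.
    apply/idP/eqP => [/andP[kp _]|->//]; apply/eqP; apply: contraTT kp => ki.
    by rewrite hk ?ltxx.
  rewrite [X in _ --> X](_ : _ = `|\det M| / b i *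
    \prod_(j | j != i) (if b j == 0 then (a j)^-1 else 0)); first exact: lim.
  have -> : \prod_(j | j != i) (if b j == 0 then (a j)^-1 else 0) =
      (\prod_j (support_fun P (row j (row' i M)) + dot (row j (row' i M)) z0))^-1.
    rewrite big_neq_lift -prodfV; apply: eq_bigr => j _.
    by rewrite /b hk ?mulr0 ?eqxx ?row_row' // eq_sym neq_lift.
  rewrite mulrAC; congr (_ / _); rewrite /b.
  apply/eqP; rewrite eqr_div ?mulf_neq0 ?(gt_eqF pp) ?(gt_eqF ip) //.
  by rewrite mulrCA (facet_det p0 fi uM) (mulrC (dot p p)) mulrCA.
rewrite big_pred0 //.
have [i ip] : exists i, dot (row i M) p != 0.
  apply: contrapT => H; have := pp; rewrite (dot_coord p p uM) big1 ?ltxx // => k _.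
  have [->|ne] := eqVneq (dot (row k M) p) 0; first by rewrite mulr0.
  by case: H; exists k.
have bi : b i != 0 by rewrite mulf_neq0.
have [k /andP[ki kp]] : exists k, (k != i) && (dot (row k M) p != 0).
  have := no i; rewrite /facet_at lt_def ip pM /= => /negbT/forallPn[k].
  by rewrite negb_imply => h; exists k.
rewrite [X in _ --> X](_ : _ = `|\det M| / b i *
    \prod_(j | j != i) (if b j == 0 then (a j)^-1 else 0)); first exact: lim.
by rewrite (bigD1 k) //= /b mulf_eq0 (negbTE s0) (negbTE kp) mul0r mulr0.
Qed.

(** Factors that vary with t are nonzero for large t, and the constant ones are nonzero by
    [ray_regular]. *)
Lemma half_vol_eval (s : R) z0 : s != 0 -> proj_regular P p T0 z0 ->
  \forall t \near +oo, rat_eval (half_vol P p T') (z0 + t *: (s *: p)) =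
    \sum_(M <- T' | pos_cone p M) `|\det M| / \prod_j (support_fun P (row j M)
       + dot (row j M) z0 + t * (s * dot (row j M) p)).
Proof.
move=> s0 reg.
pose L := [seq (support_fun P (row j M) + dot (row j M) z0, s * dot (row j M) p)
           | M <- T', j <- enum 'I_d].
have HL ab : ab \in L -> ab.2 = 0 -> ab.1 != 0.
  move=> /allpairsP[[M j] /= [MT _ ->]] /= /eqP.
  rewrite mulf_eq0 (negbTE s0) /= => /eqP vp.
  exact: (ray_regular aP tT0 (refined_ray tT' j MT) vp reg).
near=> t; have Lt : forall ab, ab \in L -> ab.1 + t * ab.2 != 0.
  by near: t; apply: affine_neq0_near.
apply: rat_evalE; apply: frac_val_sum => M MT _.
have E j : support_fun P (row j M) + dot (row j M) (z0 + t *: (s *: p)) =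
  support_fun P (row j M) + dot (row j M) z0 + t * (s * dot (row j M) p).
  by rewrite dotDr !dotZr addrA.
under eq_bigr do rewrite -E.
apply: cone_term_val => j; rewrite E.
by apply: (Lt (_, _)); apply/allpairsP; exists (M, j); rewrite mem_enum.
Unshelve. all: by end_near. Qed.

Lemma half_vol_limit (s : R) z0 : s != 0 -> proj_regular P p T0 z0 ->
  t * rat_eval (half_vol P p T') (z0 + t *: (s *: p)) @[t --> +oo] -->
  dual_vol_proj P p T0 z0 / (s * dot p p).
Proof.
move=> s0 reg; rewrite (dual_vol_proj_facets p0 aP tT' tT0 ziP reg).
rewrite mulr_suml (bigID (pos_cone p)) /= [X in _ --> _ + X]big1 ?addr0; last first.
  move=> M npos; rewrite big_pred0 ?mul0r // => i.
  by apply: contraNF npos; apply: facet_at_pos.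
rewrite big_seq_cond.
have h : \sum_(M <- T' | (M \in T') && pos_cone p M)
   t * (`|\det M| / \prod_j (support_fun P (row j M) + dot (row j M) z0
         + t * (s * dot (row j M) p))) @[t --> +oo] -->
  \sum_(M <- T' | (M \in T') && pos_cone p M)
   (\sum_(i | facet_at p M i) `|\det (lift_cone p (row' i M))| /
     \prod_j (support_fun P (row j (row' i M)) + dot (row j (row' i M)) z0))
  / (s * dot p p).
  apply: cvg_big => [|M /andP[MT pM]]; first exact: add_continuous.
  by rewrite mulr_suml; apply: cone_term_limit.
apply: cvg_trans h; apply: near_eq_cvg.
have := half_vol_eval s0 reg; apply: filterS => t ->.
by rewrite mulr_sumr -big_seq_cond.
Qed.
End Limit.

(** * Uniqueness of the splitting *)

Section Uniqueness.
Variables (R : realType) (n : nat).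
Local Notation d := n.+1.
Implicit Types (v u z : 'rV[R]_d).

Lemma poly_ext (q r : {poly R}) : (forall t, q.[t] = r.[t]) -> q = r.
Proof.
move=> h; apply/eqP; rewrite -subr_eq0; apply/eqP.
by apply: (@poly_eq0_infinite _ _ 1) => // t _; rewrite !hornerE h subrr.
Qed.

Lemma coprimep_big (I : eqType) (s : seq I) (C : pred I) (F : I -> {poly R}) q :
  (forall i, i \in s -> C i -> coprimep q (F i)) ->
  coprimep q (\prod_(i <- s | C i) F i).
Proof.
move=> h; rewrite big_seq_cond; elim/big_rec: _ => [|i x /andP[si Ci] qx].
  exact: coprimep1.
by rewrite coprimepMr h.
Qed.

Lemma line_polyM z w (f g : 'RX[R]_d) :
  line_poly z w (f * g) = line_poly z w f * line_poly z w g.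
Proof. exact: (rmorphM (mmap polyC _)). Qed.

Lemma dual_factor_line (P : set 'rV[R]_d) v z w t :
  meval ((z + t *: w) 0) (dual_factor P v) =
  support_fun P v + dot v z + t * dot v w.
Proof. by rewrite dual_factor_eval dotDr dotZr addrA. Qed.

(* Its value at z is constant along p and vanishes if and only if the factors of
   u and v have a common zero on the line through z in direction p. *)
Definition resultant_along (P : set 'rV[R]_d) (p v u : 'rV[R]_d) : 'RX[R]_d :=
  dot v p *: dual_factor P u - dot u p *: dual_factor P v.

Lemma line_coprime P p v u z : meval (z 0) (resultant_along P p v u) != 0 ->
  coprimep (line_poly z p (dual_factor P v)) (line_poly z p (dual_factor P u)).
Proof.
move=> r0; apply/Bezout_coprimepP.
(* These coefficients eliminate t and leave the nonzero constant resultant. *)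
exists ((- dot u p)%:P, (dot v p)%:P) => /=.
suff -> : (- dot u p)%:P * line_poly z p (dual_factor P v) +
    (dot v p)%:P * line_poly z p (dual_factor P u) =
    (meval (z 0) (resultant_along P p v u))%:P.
  by rewrite polyC_eqp1.
apply: poly_ext => t; rewrite !hornerE !line_poly_horner !dual_factor_line.
rewrite /resultant_along mevalB !mevalZ !dual_factor_eval.
by ring.
Qed.

Variables (P : set 'rV[R]_d) (p : 'rV[R]_d) (T T' : seq 'M[R]_d)
  (T0 : seq 'M[R]_(n, d)) (G : seq 'rV[R]_d) (zi : 'rV[R]_d).
Hypotheses (p0 : p != 0) (aP : attains P) (fP : full_dim P)
  (tT' : triangulation setT (minkowski_sum P (sym_segment p)) T')
  (tT0 : triangulation (hyperplane p) (quotient_polytope P p) T0)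
  (rG : ray_gens setT (minkowski_sum P (sym_segment p)) G)
  (ziP : forall v, v != 0 -> 0 < support_fun P v + dot v zi).

Lemma gen_ray v : v \in G -> ray_gen setT (minkowski_sum P (sym_segment p)) v.
Proof. by case: rG => _ + _; apply. Qed.

Lemma new_ray_orth v : v \in G -> ~~ is_old_ray P v -> dot v p = 0.
Proof.
move=> vG /asboolPn new; apply/eqP; apply: contrapT => /negP vp; apply: new.
have rv := gen_ray vG; case: (ltrgtP (dot v p) 0) vp => // vp _.
  apply: (@old_ray_pos _ _ P (- p)) => //; first by rewrite sym_segmentN.
  by rewrite dotNr oppr_gt0.
exact: old_ray_pos rv vp.
Qed.

(** Where it is nonzero, the projection of z to H is regular, and factors of B_+ and B_- have no
    common zero on the line through z along p. *)
Definition bad_locus : 'RX[R]_d :=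
  (\prod_(A <- T0) \prod_j dual_factor P (row j A)) *
  \prod_(v <- G | is_old_ray P v && (0 < dot v p))
    \prod_(u <- G | is_old_ray P u && (dot u p < 0)) resultant_along P p v u.

(** At the interior point zi all factors are positive, and <u, p> < 0 < <v, p> makes each resultant
    a sum of two positive terms. *)
Lemma bad_locus_neq0 : bad_locus != 0.
Proof.
suff : meval (zi 0) bad_locus != 0 by apply: contraNneq => ->; rewrite meval0.
rewrite mevalM !rmorph_prod /= mulf_neq0 // prodf_seq_neq0.
  apply/allP => A AT; rewrite rmorph_prod /=; apply/prodf_neq0 => j _.
  by rewrite dual_factor_eval gt_eqF // ziP //; exact: (quotient_row_neq0 tT0 j AT).
apply/allP => v vG; apply/implyP => /andP[_ vp]; rewrite rmorph_prod prodf_seq_neq0.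
apply/allP => u uG; apply/implyP => /andP[_ up] /=.
have [v0 _] := gen_ray vG; have [u0 _] := gen_ray uG.
rewrite mevalB !mevalZ !dual_factor_eval gt_eqF // subr_gt0.
by apply: (@lt_trans _ _ 0); [rewrite nmulr_rlt0 // ziP|rewrite mulr_gt0 // ziP].
Qed.

Lemma resultant_const v u z t :
  meval ((z + t *: p) 0) (resultant_along P p v u) = meval (z 0) (resultant_along P p v u).
Proof.
by rewrite !mevalB !mevalZ !dual_factor_line !dual_factor_eval; ring.
Qed.

(** The first hypothesis writes the difference also as C / (B_- B_0 D). On the line, B_+ then
    divides A B_- and, being coprime to B_-, divides A. *)
Lemma difference_vanishes (A C : 'RX[R]_d) (f g : 'rV[R]_d -> R) z0 (l : R) :
  A * B_neg P p G = C * B_pos P p G ->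
  proj_regular P p T0 z0 -> dot z0 p = 0 ->
  (forall v u, v \in G -> u \in G -> is_old_ray P v && (0 < dot v p) ->
     is_old_ray P u && (dot u p < 0) -> meval (z0 0) (resultant_along P p v u) != 0) ->
  (forall z : 'rV[R]_d, meval (z 0) (B_pos P p G * B_zero P p G * D_new P G) != 0 ->
     f z - g z = meval (z 0) A / meval (z 0) (B_pos P p G * B_zero P p G * D_new P G)) ->
  t * f (z0 + t *: p) @[t --> +oo] --> l ->
  t * g (z0 + t *: p) @[t --> +oo] --> l ->
  line_poly z0 p A = 0.
Proof.
move=> AC reg z0p res fg fl gl.
have lineprod (C' : pred 'rV[R]_d) :
    line_poly z0 p (\prod_(v <- G | C' v) dual_factor P v) =
    \prod_(v <- G | C' v) line_poly z0 p (dual_factor P v).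
  exact: (rmorph_prod (mmap polyC _)).
have cop : coprimep (line_poly z0 p (B_pos P p G)) (line_poly z0 p (B_neg P p G)).
  rewrite !lineprod coprimep_sym; apply: coprimep_big => v vG vC.
  rewrite coprimep_sym; apply: coprimep_big => u uG uC.
  by apply: line_coprime; apply: res.
have /divpK qE : line_poly z0 p (B_pos P p G) %| line_poly z0 p A.
  by rewrite -(Gauss_dvdpl _ cop) -line_polyM AC line_polyM dvdp_mull.
set q := _ %/ _ in qE.
pose k := meval (z0 0) (B_zero P p G * D_new P G).
have reg0 v : v \in G -> dot v p = 0 -> support_fun P v + dot v z0 != 0.
  by move=> vG vp; exact: (ray_regular aP tT0 (gen_ray vG) vp reg).
have constC (C' : pred 'rV[R]_d) t : (forall v, v \in G -> C' v -> dot v p = 0) ->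
   meval ((z0 + t *: p) 0) (\prod_(v <- G | C' v) dual_factor P v) =
   meval (z0 0) (\prod_(v <- G | C' v) dual_factor P v).
  move=> hC; rewrite !rmorph_prod /= big_seq_cond [RHS]big_seq_cond.
  apply: eq_bigr => v /andP[vG vC].
  by rewrite dual_factor_line dual_factor_eval hC // mulr0 addr0.
have nzC (C' : pred 'rV[R]_d) : (forall v, v \in G -> C' v -> dot v p = 0) ->
   meval (z0 0) (\prod_(v <- G | C' v) dual_factor P v) != 0.
  move=> hC; rewrite rmorph_prod prodf_seq_neq0; apply/allP => v vG; apply/implyP => vC.
  by rewrite /= dual_factor_eval reg0 // hC.
have B0p v : v \in G -> is_old_ray P v && (dot v p == 0) -> dot v p = 0.
  by move=> _ /andP[_ /eqP].
have kE t : meval ((z0 + t *: p) 0) (B_zero P p G * D_new P G) = k.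
  rewrite /k !mevalM; congr (_ * _); apply: constC => //.
  exact: new_ray_orth.
have k0 : k != 0.
  rewrite /k mevalM mulf_neq0 //; apply: nzC => //; exact: new_ray_orth.
clearbody k.
have lim0 : ('X * q).[t] @[t --> +oo] --> (0 : R).
  have h : (t * f (z0 + t *: p) - t * g (z0 + t *: p)) * k @[t --> +oo] --> (l - l) * k.
    by apply: cvgMl; apply: cvgB.
  rewrite subrr mul0r in h; apply: cvg_trans h; apply: near_eq_cvg; near=> t.
  have Bp : meval ((z0 + t *: p) 0) (B_pos P p G) != 0.
    rewrite rmorph_prod prodf_seq_neq0; apply/allP => v vG; apply/implyP => /andP[_ vp] /=.
    rewrite dual_factor_line.
    suff : forall ab, ab \in [seq (support_fun P v + dot v z0, dot v p) | v : 'rV[R]_d <- G] ->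
        ab.1 + t * ab.2 != 0 by move=> /(_ (_, _)); apply; apply: map_f.
    near: t; apply: affine_neq0_near => _ /mapP[v' vG' ->] /=.
    exact: reg0.
  have den : meval ((z0 + t *: p) 0) (B_pos P p G * B_zero P p G * D_new P G) =
      meval ((z0 + t *: p) 0) (B_pos P p G) * k by rewrite -mulrA mevalM kE.
  rewrite -mulrBr fg den ?mulf_neq0 // -!line_poly_horner -qE !hornerM hornerX.
  rewrite line_poly_horner. field.
  by rewrite Bp k0.
(* ['X * q] has size at least 2 unless q = 0. *)
have := poly_cvg_const lim0.
have [q0 _|q0] := eqVneq q 0; first by rewrite -qE q0 mul0r.
by rewrite mulrC size_mulX // ltnS leqn0 size_poly_eq0 (negbTE q0).
Unshelve. all: by end_near. Qed.

Lemma splitting_unique W W' :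
  is_splitting P p T T0 G W -> is_splitting P p T T0 G W' -> W = W'.
Proof.
move=> [sumW [[A1 E1] [A2 E2]] limW] [sumW' [[A1' E1'] [A2' E2']] limW'].
set Dp := _ * _ * _ in E1 E1'; set Dm := _ * _ * _ in E2 E2'.
have G0 (C : pred 'rV[R]_d) : \prod_(v <- G | C v) dual_factor P v != 0.
  rewrite prodf_seq_neq0; apply/allP => v vG; apply/implyP => _.
  have [v0 _] := gen_ray vG.
  by apply: (@neq0_of_morph _ _ (meval (zi 0))); rewrite /= dual_factor_eval gt_eqF // ziP.
have Dp0 : Dp != 0 by rewrite !mulf_neq0 // G0.
have Dm0 : Dm != 0 by rewrite !mulf_neq0 // G0.
have diff : W.1 - W'.1 = W'.2 - W.2.
  by apply/eqP; rewrite subr_eq addrAC eq_sym subr_eq [_ + W'.1]addrC sumW' sumW.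
suff A0 : A1 = A1'.
  have e1 : W.1 = W'.1 by rewrite E1 E1' A0.
  move/esym/eqP: diff; rewrite e1 subrr subr_eq0 => /eqP e2.
  by case: W W' e1 e2 {E1 E2 E1' E2' sumW sumW' limW limW'} => [a b] [a' b'] /= -> ->.
apply/eqP; rewrite -subr_eq0.
have AC : (A1 - A1') * B_neg P p G = (A2' - A2) * B_pos P p G.
  have : tofrac (A1 - A1') / tofrac Dp == tofrac (A2' - A2) / tofrac Dm.
    by rewrite !rmorphB !mulrBl -E1 -E1' -E2 -E2' diff.
  rewrite frac_eqP // /Dm /Dp -!mulrA !mulrA -!(mulrA _ (B_zero _ _ _)).
  by rewrite -!mulrA => /eqP; rewrite !mulrA => /(mulIf (G0 _))/(mulIf (G0 _)).
(* Multiplication by a nonzero polynomial leaves only points z with a generic line to be checked. *)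
suff : (A1 - A1') * bad_locus = 0.
  by move/eqP; rewrite mulf_eq0 (negbTE bad_locus_neq0) orbF.
apply: mpoly_vanish => z'; pose z : 'rV[R]_d := \row_i z' i.
have zE f : meval z' f = meval (z 0) f by apply: meval_eq => i; rewrite mxE.
rewrite zE mevalM; apply/eqP; rewrite mulf_eq0 orbC.
have [//|nz] := eqVneq (meval (z 0) bad_locus) 0; apply/eqP.
move: nz; rewrite mevalM mulf_eq0 negb_or => /andP[nz0 nz1].
pose z0 := orth_proj p z; pose s := dot z p / dot p p.
have zz0 : z0 + s *: p = z by rewrite addrC orth_projK.
have z0p : dot z0 p = 0 by exact: orth_proj_dot.
have reg : proj_regular P p T0 z0.
  move=> A AT j; have [_ hQ] := attains_quotient p aP.
  have rp := quotient_orth tT0 AT j.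
  rewrite /quotient_polytope hQ //.
  move: nz0; rewrite rmorph_prod prodf_seq_neq0 => /allP/(_ _ AT) /=.
  rewrite rmorph_prod => /prodf_neq0/(_ j isT) /=.
  by rewrite -zz0 dual_factor_line rp mulr0 addr0.
have res v u : v \in G -> u \in G -> is_old_ray P v && (0 < dot v p) ->
     is_old_ray P u && (dot u p < 0) -> meval (z0 0) (resultant_along P p v u) != 0.
  (* Resultants are constant along p, so they are nonzero at z0 because they are at z. *)
  move=> vG uG vC uC; rewrite -(resultant_const _ _ _ s) zz0.
  move: nz1; rewrite rmorph_prod prodf_seq_neq0 => /allP/(_ _ vG); rewrite vC /=.
  by rewrite rmorph_prod prodf_seq_neq0 => /allP/(_ _ uG); rewrite uC.
have [limp _] := limW _ z0p reg; have [limp' _] := limW' _ z0p reg.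
have fg (w : 'rV[R]_d) : meval (w 0) Dp != 0 ->
    rat_eval W.1 w - rat_eval W'.1 w = meval (w 0) (A1 - A1') / meval (w 0) Dp.
  move=> w0; rewrite E1 E1' mevalB mulrBl.
  by congr (_ - _); apply: rat_evalE; apply: frac_val_div.
have := difference_vanishes AC reg z0p res fg limp limp'.
by move=> /(congr1 (horner^~ s)); rewrite line_poly_horner zz0 horner0.
Qed.
End Uniqueness.

Section Opposite.
Variables (R : realType) (n : nat).
Local Notation d := n.+1.
Variables (P : set 'rV[R]_d) (p : 'rV[R]_d) (T0 : seq 'M[R]_(n, d)).

Lemma proj_regularN z : proj_regular P (- p) T0 z <-> proj_regular P p T0 z.
Proof. by rewrite /proj_regular quotient_polytopeN. Qed.

Lemma dual_vol_projN z : dual_vol_proj P (- p) T0 z = dual_vol_proj P p T0 z.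
Proof.
rewrite /dual_vol_proj quotient_polytopeN; apply: eq_bigr => A _; congr (_ / _).
have -> : col_mx (- p) A = lift_cone (- p) A by [].
have -> : lift_cone (- p) A = diag_mx (cons_row (-1) (const_mx 1)) *m lift_cone p A.
  have rowD (e : 'rV[R]_d) (M : 'M[R]_d) i : row i (diag_mx e *m M) = e 0 i *: row i M.
    by apply/rowP => j; rewrite mul_diag_mx !mxE.
  apply/row_matrixP => i; rewrite rowD.
  case: (unliftP ord0 i) => [j ->|->].
    by rewrite !row_lift_coneS cons_rowS mxE scale1r.
  by rewrite !row_lift_cone0 cons_row0 scaleN1r.
rewrite det_mulmx det_diag big_ord_recl cons_row0 big1 ?mulr1 ?mulN1r ?normrN // => i _.
by rewrite cons_rowS mxE.
Qed.
End Opposite.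

Theorem theorem12p3 (R : realType) (n : nat)
  (P : set 'rV[R]_n.+1) (p : 'rV[R]_n.+1)
  (T T' : seq 'M[R]_n.+1) (T0 : seq 'M[R]_(n, n.+1)) (G : seq 'rV[R]_n.+1) :
  polytope P -> full_dim P -> p != 0 ->
  triangulation setT P T ->
  triangulation setT (minkowski_sum P (sym_segment p)) T' ->
  triangulation (hyperplane p) (quotient_polytope P p) T0 ->
  ray_gens setT (minkowski_sum P (sym_segment p)) G ->
  (exists! W : 'RF[R]_n.+1 * 'RF[R]_n.+1, is_splitting P p T T0 G W) /\
  (forall W : 'RF[R]_n.+1 * 'RF[R]_n.+1, is_splitting P p T T0 G W ->
     dual_vol_x P p T' =
       rat_subst (shift_along p) W.1 + rat_subst (shift_along (- p)) W.2).
Proof.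
move=> pP fP p0 tT tT' tT0 rG.
have P0 := full_dim_neq0 (ltn0Sn n) fP; have aP := polytope_attains pP P0.
have [zi ziP] := polytope_interior pP fP P0.
have aS : attains (minkowski_sum P (sym_segment p)) by have [] := attains_minkowski p aP.
have HT' M : M \in T' -> M \in unitmx /\ one_sided p M.
  by move=> MT; split; [exact: triangulation_unit tT' MT|exact: (refined_one_sided aP tT' MT)].
have pN0 : - p != 0 by rewrite oppr_eq0.
have tT'N : triangulation setT (minkowski_sum P (sym_segment (- p))) T'.
  by rewrite sym_segmentN.
have tT0N : triangulation (hyperplane (- p)) (quotient_polytope P (- p)) T0.
  by rewrite hyperplaneN quotient_polytopeN.
pose W := (half_vol P p T', half_vol P (- p) T').
have den q (B := half_denominator P q G) : has_denominator (half_vol P q T') B.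
  have G0 v : v \in G -> dual_factor P v != 0.
    move=> vG; have [v0 _] := gen_ray rG vG.
    by apply: (@neq0_of_morph _ _ (meval (zi 0))); rewrite /= dual_factor_eval gt_eqF // ziP.
  apply: has_denominator_sum => [|M MT qM].
    rewrite /B prodf_seq_neq0; apply/allP => v vG; apply/implyP => _; exact: G0.
  apply: (cone_term_denominator aP _ qM rG) => // [|i]; first by have [] := HT' _ MT.
  exact: (refined_ray tT' i MT).
have WP : is_splitting P p T T0 G W.
  split=> [|/=|z0 z0p reg /=].
  - rewrite half_vol_sum //; apply/esym/(dual_vol_indep ziP aP aS tT tT') => M.
    rewrite mem_cat => /orP[/(triangulation_linear tT)//|].
    by move=> MT; exact: (refined_linear aP tT' MT).
  - by rewrite -half_denominatorE -half_denominatorN.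
  split.
    have := half_vol_limit p0 aP tT' tT0 ziP (oner_neq0 _) reg.
    by rewrite scale1r mul1r.
  have N1 : (-1 : R) != 0 by rewrite oppr_eq0 oner_neq0.
  (* The scalar -1 turns the direction -p back into p and produces the minus sign of the limit. *)
  have := half_vol_limit pN0 aP tT'N tT0N ziP N1 ((proj_regularN P p T0 z0).2 reg).
  by rewrite scaleN1r opprK dual_vol_projN dotNl dotNr opprK mulN1r invrN mulrN.
have uW W' : is_splitting P p T T0 G W' -> W = W'.
  exact: (splitting_unique p0 aP fP tT0 rG ziP WP).
split; first by exists W.
move=> W' /uW <-; exact: dual_vol_x_split p0 ziP HT'.
Qed.
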